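(* Let $H(n)$ be the number of subsets of $\{1,2,\ldots,n\}$ free of 3-term geometric progressions with integral ratio. The limit $\theta=\lim_{n \to \infty} H(n)^{1/n}$ exists. Furthermore, for any $\epsilon>0$ and $n$ sufficiently large, \[H(n) = \theta^{n\left(1+O\left(\exp\left(-\sqrt{\left(\frac{1}{6}-\epsilon\right)\log n \log \log n}\right)\right)\right)}.\] The constant $\theta$ is effectively computable and satisfies $1.901448 < \theta < 1.925556$.
   Context: A 3-term geometric progression with integral ratio is a triple $a, ar, ar^2$ with $a$ a positive integer and $r>1$ an integer. A set is free of such progressions if it does not contain all three terms of any such triple. *)

(* Defs.v *)
From mathcomp Require Import all_boot all_order all_algebra.
From mathcomp Require Import all_classical all_reals all_analysis.

Set Implicit Arguments.
Unset Strict Implicit.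
Unset Printing Implicit Defensive.

Import Order.TTheory GRing.Theory Num.Theory.
Import numFieldNormedType.Exports.

Local Open Scope ring_scope.

Definition is_gp3 (a b c : nat) : Prop :=
  exists r : nat, [/\ (0 < a)%N, (1 < r)%N, b = (a * r)%N & c = (a * r ^ 2)%N].

Definition gp3_free (n : nat) (A : {set 'I_n.+1}) : Prop :=
  forall a b c : 'I_n.+1, a \in A -> b \in A -> c \in A -> ~ is_gp3 a b c.

(* 'I_n.+1 is {0, ..., n}, so the subsets of {1, ..., n} are those that
   avoid ord0. *)
Definition H (n : nat) : nat :=
  #|[set A : {set 'I_n.+1} | (A \subset [set~ ord0]) && `[< gp3_free A >]]|.

(* Kleene's partial recursive functions, with arguments passed as a list;
   missing arguments read as 0. *)
Inductive recfun : Type :=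
  | Zero
  | Succ
  | Proj of nat
  | Comp of recfun & seq recfun
  | PrimRec of recfun & recfun
  | Mu of recfun.

Inductive reval : recfun -> seq nat -> nat -> Prop :=
  | reval_Zero s : reval Zero s 0
  | reval_Succ s : reval Succ s (nth 0%N s 0).+1
  | reval_Proj i s : reval (Proj i) s (nth 0%N s i)
  | reval_Comp f gs s vs v :
      revals gs s vs -> reval f vs v -> reval (Comp f gs) s v
  | reval_PrimRec0 f g s v : reval f s v -> reval (PrimRec f g) (0%N :: s) v
  | reval_PrimRecS f g k s u v :
      reval (PrimRec f g) (k :: s) u -> reval g [:: k, u & s] v ->
      reval (PrimRec f g) (k.+1 :: s) v
  | reval_Mu f s k (w : nat -> nat) :
      (forall j, (j < k)%N -> reval f (j :: s) (w j).+1) ->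
      reval f (k :: s) 0 -> reval (Mu f) s k
with revals : seq recfun -> seq nat -> seq nat -> Prop :=
  | revals_nil s : revals [::] s [::]
  | revals_cons g gs s v vs :
      reval g s v -> revals gs s vs -> revals (g :: gs) s (v :: vs).

Definition computable (f : nat -> nat) : Prop :=
  exists e : recfun, forall n, reval e [:: n] (f n).

(* x is effectively computable: some algorithm returns, on input k, a rational
   (p k - q k) / (d k + 1) within 2 ^ - k of x. *)
Definition computable_real (R : realType) (x : R) : Prop :=
  exists p q d : nat -> nat,
    [/\ computable p, computable q, computable d &
        forall k, `|x - ((p k)%:R - (q k)%:R) / (d k).+1%:R| <= 2 ^- k].

(* Main.v *)
(** The loss of a hypergraph on [v] vertices is [v * ln 2 - ln h], where [h] is
    the number of vertex sets containing no edge; with [D n] the loss of the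
    hypergraph of progressions in [{1, ..., n}], [ln (H n) = n * ln 2 - D n]. By
    the Harris-Kleitman inequality the loss is subadditive in the edge set, so
    the progressions whose ratio exceeds [y] account for at most
    [n * ln 2 / y ^ 2]. For ratios composed of the primes [p <= y], the
    hypergraph splits, according to the [y]-rough part [m] of the vertices, into
    copies of the hypergraph on the [y]-smooth numbers up to [n / m]. Counting
    the [m] by Legendre's sieve with Rankin's trick, and taking
    [y = exp (sqrt (ln n * ln (ln n)) / 4)], shows that [D n / n] is a Cauchy
    sequence with rate [exp (- sqrt (ln n * ln (ln n)) / 2)].

    For the numerical bounds the primes 2 and 3 suffice. Along multiples [n] of a
    fixed integer the numbers of rough parts are exact, and the free sets in the
    resulting finite hypergraphs are counted by dynamic programming. For the
    lower bound the integers outside a window of each block are given up, and the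
    ratios 5 and 7 are charged by the Harris-Kleitman inequality.

    Since the rate is explicit, [H N ^ (1 / N)] for [N = 2 ^ 4 ^ (k + C)], rounded
    down, approximates the limit to within [2 ^ - k]. *)

From Stdlib Require Import NArith.
Require Import Defs.
From mathcomp Require Import all_boot all_order all_algebra.
From mathcomp Require Import all_classical all_reals all_analysis.
From mathcomp Require Import zify ring lra.

Set Implicit Arguments.
Unset Strict Implicit.
Unset Printing Implicit Defensive.

Import Order.TTheory GRing.Theory Num.Theory.
Import numFieldNormedType.Exports.

Local Open Scope ring_scope.

(** Write [a = sqrt (ln n)] and [b = sqrt (ln (ln n))]. In Rankin's trick the exponent [1 - b / a]
    gains [n ^ (- b / a) = exp (- a b)]; the price is the exponential of 5 times the sum of
    [p ^ (b / a - 1)] over the primes [p <= y]. With [y = exp (a b / 4)] the factor [p ^ (b / a)] is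
    at most [exp (b ^ 2 / 4) = (ln n) ^ (1 / 4)], so a bound of order [sqrt (ln y)] for the sum of
    [1 / p] keeps the price below [exp (a b / 2)]. Chebyshev's estimate on dyadic blocks gives this
    without Mertens' theorem. The two errors balance, since [y ^ -2] is [exp (- a b / 2)] as well.
    As [1 / 4 > 1 / 6], the rate is sharper than the stated one.

    The quotients [n / m] in the block decomposition are rounded. Expanding the block losses into
    increments leaves only counts of rough numbers, to which the sieve applies. Two values of [n]
    are compared through one common finite sum of increments, and the limit is obtained as a
    supremum. *)

(** * Loss of a hypergraph *)

(* The number of subsets [X] of the duplicate-free list [s] with [E X]. *)
Fixpoint cnt (s : seq nat) (E : pred (pred nat)) : nat :=
  if s is x :: s' then (cnt s' E + cnt s' (fun X => E (predU1 x X)))%N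
  else E pred0.

Definition edge_free (L : seq (seq nat)) (X : pred nat) : bool :=
  all (fun e => ~~ all X e) L.

Definition antitone (E : pred (pred nat)) :=
  forall X Y : pred nat, (forall z, X z -> Y z) -> E Y -> E X.

Lemma edge_free_antitone L : antitone (edge_free L).
Proof.
move=> X Y XY /allP h; apply/allP => e /h; apply: contra.
by move=> /allP a; apply/allP => z /a /XY.
Qed.

Lemma leq_cnt s (E E' : pred (pred nat)) :
    (forall X : pred nat, (forall z, X z -> z \in s) -> E X -> E' X) ->
  (cnt s E <= cnt s E')%N.
Proof.
elim: s E E' => [|x s IH] E E' h /=.
  by case e: (E pred0) => //; rewrite (h _ _ e).
apply: leq_add; apply: IH => X hX.
  by apply: h => z /hX zs; rewrite inE zs orbT.
by apply: h => z /predU1P[->|/hX zs]; rewrite inE ?eqxx // zs orbT.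
Qed.

Lemma eq_cnt s (E E' : pred (pred nat)) :
    (forall X : pred nat, (forall z, X z -> z \in s) -> E X = E' X) ->
  cnt s E = cnt s E'.
Proof.
move=> h; apply/eqP; rewrite eqn_leq; apply/andP.
by split; apply: leq_cnt => X hX; rewrite h.
Qed.

Lemma cnt_le s E : (cnt s E <= 2 ^ size s)%N.
Proof.
by elim: s E => [|x s IH] E /=; rewrite ?leq_b1 // expnS mul2n -addnn leq_add.
Qed.

(* The Harris-Kleitman inequality. *)
Lemma cnt_harris s E E' : antitone E -> antitone E' ->
  (cnt s E * cnt s E' <= 2 ^ size s * cnt s (fun X => E X && E' X))%N.
Proof.
elim: s E E' => [|x s IH] E E' aE aE' /=.
  by rewrite mul1n; case: (E _); case: (E' _).
pose add F (X : pred nat) := F (predU1 x X) : bool.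
have add_anti F : antitone F -> antitone (add F).
  move=> aF X Y XY; apply: aF => z /predU1P[->|/XY zY]; apply/predU1P; auto.
have add_le F : antitone F -> (cnt s (add F) <= cnt s F)%N.
  by move=> aF; apply: leq_cnt => X _; apply: aF => z zX; apply/predU1P; right.
have h0 := IH _ _ aE aE'.
have h1 := IH _ _ (add_anti _ aE) (add_anti _ aE').
have leE := add_le _ aE; have leE' := add_le _ aE'.
rewrite -/(add E) -/(add E') -/(add (fun X => E X && E' X)) in h0 h1 leE leE' *.
(* Chebyshev's sum inequality for two terms: the difference of the two sides is [(a - b) * (c - d)],
   and both factors are nonnegative because adding [x] lowers either count. *)
have rearr : ((cnt s E + cnt s (add E)) * (cnt s E' + cnt s (add E')) <=
    2 * (cnt s E * cnt s E' + cnt s (add E) * cnt s (add E')))%N.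
  move: leE leE'; set a := cnt s E; set b := cnt s (add E).
  set c := cnt s E'; set d := cnt s (add E') => leE leE'.
  rewrite -(subnKC leE) -(subnKC leE'); set u := (a - b)%N; set v := (c - d)%N.
  by rewrite !mulnDl !mulnDr; nia.
apply: (leq_trans rearr); rewrite expnS -mulnA leq_mul2l /= mulnDr.
exact: leq_add.
Qed.

Lemma cnt_swap s x y E : cnt (x :: y :: s) E = cnt (y :: x :: s) E.
Proof.
have swap X : predU1 x (predU1 y X) = predU1 y (predU1 x X) :> pred nat.
  by apply: funext => z; rewrite /= orbCA.
rewrite /= -!addnA; congr (_ + _)%N; rewrite !addnA; congr (_ + _)%N.
  by rewrite addnC.
by apply: eq_cnt => X _; rewrite swap.
Qed.

Lemma cnt_mid s1 x s2 E : cnt (s1 ++ x :: s2) E = cnt (x :: s1 ++ s2) E.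
Proof.
elim: s1 E => // y s1 IH E; rewrite !cat_cons cnt_swap.
by rewrite [LHS]/(cnt _ _ + cnt _ _)%N !IH.
Qed.

Lemma perm_cnt s t E : perm_eq s t -> cnt s E = cnt t E.
Proof.
elim: s t E => [|x s IH] t E; first by move/perm_size/esym/size0nil->.
move=> st; have xt : x \in t by rewrite -(perm_mem st) mem_head.
case/splitPr: xt st => t1 t2; rewrite cnt_mid perm_sym.
rewrite -[x :: t2]cat1s perm_catCA cat1s perm_cons perm_sym => st.
by rewrite /= !(IH (t1 ++ t2)).
Qed.

Lemma cnt_cat_indep s t (E : pred (pred nat)) :
    (forall X Y : pred nat, {in s, X =1 Y} -> E X = E Y) ->
  {in t, forall x, x \notin s} -> cnt (t ++ s) E = (2 ^ size t * cnt s E)%N.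
Proof.
move=> indep; elim: t => [|x t IH] hts; first by rewrite mul1n.
have ht : {in t, forall x, x \notin s}.
  by move=> z zt; apply: hts; rewrite inE zt orbT.
have xs : x \notin s by apply: hts; rewrite mem_head.
rewrite /= expnS -mulnA mul2n -addnn -IH //; congr addn.
apply: eq_cnt => X _; apply: indep => z zs /=.
by case: eqP => // zx; rewrite -zx zs in xs.
Qed.

(** One half of the product formula for disjoint hypergraphs; the other half is the subadditivity of
    the loss. *)
Lemma cnt_cat_le s t (E F G : pred (pred nat)) :
    (forall X Y : pred nat, E (fun z => X z || Y z) -> G X && F Y) ->
  (cnt (t ++ s) E <= cnt t G * cnt s F)%N.
Proof.
elim: t E G => [|x t IH] E G h /=.
  case g0: (G pred0).
    by rewrite mul1n; apply: leq_cnt => X _ /(h pred0) /andP[].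
  rewrite mul0n (_ : cnt s E = cnt s pred0); last first.
    by apply: eq_cnt => X _; apply/negP => /(h pred0); rewrite g0.
  by rewrite leqn0; elim: s => //= y s /eqP->; rewrite add0n.
rewrite mulnDl; apply: leq_add; apply: IH => X Y; first exact: h.
move=> e; apply: (h (predU1 x X)); move: e; congr (E _ : Prop).
by apply: funext => z; rewrite /= orbA.
Qed.

Definition img (f : nat -> nat) (X : pred nat) : pred nat :=
  fun z => `[< exists2 x, X x & f x = z >].

Lemma cnt_map (f : nat -> nat) s (E : pred (pred nat)) :
  cnt [seq f x | x <- s] E = cnt s (fun X => E (img f X)).
Proof.
elim: s E => [|x s IH] E /=.
  by congr (E _ : nat); apply: funext => z; apply/esym/asboolP => -[].
rewrite !IH; congr (_ + _)%N; apply: eq_cnt => X _; congr E.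
apply: funext => z; apply/predU1P/asboolP.
  move=> [->|/asboolP[y Xy <-]]; first by exists x => //=; rewrite eqxx.
  by exists y => //=; rewrite Xy orbT.
by move=> [y /predU1P[->|Xy] <-]; [left|right; apply/asboolP; exists y].
Qed.

Lemma edge_free_img (f : nat -> nat) (s : seq nat) L (X : pred nat) :
    {in s &, injective f} -> {subset flatten L <= s} ->
    (forall z, X z -> z \in s) ->
  edge_free [seq map f e | e <- L] (img f X) = edge_free L X.
Proof.
move=> fI Ls Xs; rewrite /edge_free all_map; apply: eq_in_all => e eL /=.
rewrite all_map; congr (~~ _); apply: eq_in_all => x xe /=.
have xs : x \in s by apply: Ls; apply/flattenP; exists e.
by apply/asboolP/idP => [[y Xy /fI<-]//|Xx]; [exact: Xs|exists x].
Qed.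

Lemma eq_edge_free_in L (X Y : pred nat) : {in flatten L, X =1 Y} ->
  edge_free L X = edge_free L Y.
Proof.
move=> XY; apply: eq_in_all => e eL; congr (~~ _); apply: eq_in_all => x xe.
by apply: XY; apply/flattenP; exists e.
Qed.

Lemma edge_free_cat L1 L2 X : edge_free (L1 ++ L2) X = edge_free L1 X && edge_free L2 X.
Proof. exact: all_cat. Qed.

(* [L2] forbids every set that [L1] forbids. *)
Definition refines (L1 L2 : seq (seq nat)) :=
  {in L1, forall e, exists2 e', e' \in L2 & {subset e' <= e}}.

Lemma refines_edge_free L1 L2 X : refines L1 L2 -> edge_free L2 X -> edge_free L1 X.
Proof.
move=> h /allP f; apply/allP => e /h[e' /f fe' sub]; apply: contra fe'.
by move=> /allP a; apply/allP => x /sub /a.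
Qed.

Section Loss.
Variable R : realType.

Definition verts (L : seq (seq nat)) := undup (flatten L).

Definition loss (L : seq (seq nat)) : R :=
  (size (verts L))%:R * ln 2 - ln (cnt (verts L) (edge_free L))%:R.

Definition edges_ne (L : seq (seq nat)) := [::] \notin L.

Lemma cnt_gt0 s L : edges_ne L -> (0 < cnt s (edge_free L))%N.
Proof.
move=> ne; have : edge_free L pred0.
  by apply/allP => -[|x e] //= eL; rewrite /edges_ne eL in ne.
elim: s (edge_free L) => [|x s IH] E /= E0; first by rewrite E0.
by rewrite addn_gt0 IH.
Qed.

(** An isolated vertex doubles the count and adds [ln 2] to the first term, so the ambient list is
    immaterial. This allows two hypergraphs to be compared on a common list. *)
Lemma loss_on s L : edges_ne L -> uniq s -> {subset flatten L <= s} ->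
  loss L = (size s)%:R * ln 2 - ln (cnt s (edge_free L))%:R.
Proof.
move=> ne us sub.
pose t := [seq x <- s | x \notin verts L].
have st : perm_eq s (t ++ verts L).
  apply: uniq_perm => //.
    rewrite cat_uniq filter_uniq // undup_uniq andbT /=.
    by apply/hasPn => x xv; rewrite mem_filter xv.
  move=> x; rewrite mem_cat mem_filter.
  by case xv: (x \in verts L); rewrite ?orbT ?orbF // sub // -mem_undup.
rewrite (perm_cnt _ st) (perm_size st) size_cat cnt_cat_indep; last 2 first.
- by move=> X Y XY; apply: eq_edge_free_in => x xL; apply: XY; rewrite mem_undup.
- by move=> x; rewrite mem_filter => /andP[].
rewrite natrM natrX lnM ?posrE ?exprn_gt0 ?ltr0n ?cnt_gt0 // lnXn ?ltr0n //.
by rewrite /loss -mulr_natl natrD; ring.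
Qed.

Lemma cnt_pos_ln s L : edges_ne L -> 0 < (cnt s (edge_free L))%:R :> R.
Proof. by move=> ne; rewrite ltr0n cnt_gt0. Qed.

Lemma loss_le L1 L2 : edges_ne L1 -> edges_ne L2 -> refines L1 L2 ->
  loss L1 <= loss L2.
Proof.
move=> ne1 ne2 ref; pose s := undup (flatten L1 ++ flatten L2).
rewrite (@loss_on s L1) ?(@loss_on s L2) ?undup_uniq //;
  try by move=> x xL; rewrite mem_undup mem_cat; apply/orP; auto.
rewrite lerD2l lerN2 ler_ln ?posrE ?cnt_pos_ln // ler_nat.
by apply: leq_cnt => X _; apply: refines_edge_free.
Qed.

Lemma loss_ge0 L : edges_ne L -> 0 <= loss L.
Proof.
move=> ne; rewrite /loss subr_ge0 mulr_natl -lnXn // ler_ln ?posrE ?cnt_pos_ln //.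
by rewrite -natrX ler_nat cnt_le.
Qed.

Lemma ne_cat L1 L2 : edges_ne (L1 ++ L2) = edges_ne L1 && edges_ne L2.
Proof. by rewrite /edges_ne mem_cat negb_or. Qed.

Lemma loss_cat L1 L2 : edges_ne L1 -> edges_ne L2 ->
  loss (L1 ++ L2) <= loss L1 + loss L2.
Proof.
move=> ne1 ne2; pose s := undup (flatten L1 ++ flatten L2).
have ne12 : edges_ne (L1 ++ L2) by rewrite ne_cat ne1.
rewrite (@loss_on s L1) ?(@loss_on s L2) ?(@loss_on s (L1 ++ L2)) ?undup_uniq //;
  try by move=> x; rewrite mem_undup ?flatten_cat // mem_cat => h; apply/orP; auto.
suff : ln (cnt s (edge_free L1))%:R + ln (cnt s (edge_free L2))%:R <=
    (size s)%:R * ln 2 + ln (cnt s (edge_free (L1 ++ L2)))%:R :> R by lra.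
rewrite mulr_natl -lnXn // -!lnM ?posrE ?cnt_pos_ln ?exprn_gt0 //.
rewrite ler_ln ?posrE ?mulr_gt0 ?cnt_pos_ln ?exprn_gt0 //.
rewrite -natrX -!natrM ler_nat.
rewrite (_ : edge_free (L1 ++ L2) = (fun X => edge_free L1 X && edge_free L2 X)).
  exact: cnt_harris (@edge_free_antitone _) (@edge_free_antitone _).
by apply: funext => X; exact: edge_free_cat.
Qed.

Lemma loss_disjoint L1 L2 : edges_ne L1 -> edges_ne L2 ->
    {in flatten L1, forall x, x \notin flatten L2} ->
  loss (L1 ++ L2) = loss L1 + loss L2.
Proof.
move=> ne1 ne2 dis; apply/eqP; rewrite eq_le loss_cat //=.
have ne12 : edges_ne (L1 ++ L2) by rewrite ne_cat ne1.
rewrite (@loss_on (verts L1 ++ verts L2) (L1 ++ L2)) //; last 2 first.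
- rewrite cat_uniq !undup_uniq andbT /=; apply/hasPn => x.
  by rewrite !mem_undup; apply: contraL => /dis.
- by move=> x; rewrite flatten_cat !mem_cat !mem_undup.
rewrite /loss size_cat natrD.
suff : ln (cnt (verts L1 ++ verts L2) (edge_free (L1 ++ L2)))%:R <=
    ln (cnt (verts L1) (edge_free L1))%:R + ln (cnt (verts L2) (edge_free L2))%:R :> R.
  by lra.
rewrite -!lnM ?posrE ?cnt_pos_ln // ler_ln ?posrE ?mulr_gt0 ?cnt_pos_ln //.
rewrite -natrM ler_nat; apply: cnt_cat_le => X Y; rewrite edge_free_cat => /andP[f1 f2].
by apply/andP; split; [apply: edge_free_antitone f1|apply: edge_free_antitone f2] => z /= ->;
  rewrite ?orbT.
Qed.

Lemma loss_nil : loss [::] = 0.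
Proof. by rewrite /loss /= mul0r ln1 subr0. Qed.

Lemma loss_map (f : nat -> nat) L : {in flatten L &, injective f} ->
  edges_ne L -> loss [seq map f e | e <- L] = loss L.
Proof.
move=> fI ne; have ne' : edges_ne [seq map f e | e <- L].
  by apply: contra ne => /mapP[[|//] eL _].
have fI' : {in verts L &, injective f}.
  by move=> x y; rewrite !mem_undup; apply: fI.
rewrite (@loss_on (map f (verts L))) //.
- rewrite /loss size_map cnt_map; congr (_ - ln _%:R); apply: eq_cnt => X Xs.
  by apply: edge_free_img fI' _ Xs => x; rewrite mem_undup.
- by rewrite map_inj_in_uniq ?undup_uniq.
move=> x /flattenP[_ /mapP[e eL ->] /mapP[y ye ->]].
by apply: map_f; rewrite mem_undup; apply/flattenP; exists e.
Qed.

Lemma loss1 a : loss [:: [:: a]] = ln 2.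
Proof. by rewrite /loss /= /edge_free /= eqxx /= mul1r ln1 subr0. Qed.

(** Of the 8 subsets of three points only the full one is forbidden. *)
Lemma loss3 a b c : uniq [:: a; b; c] -> loss [:: [:: a; b; c]] = ln (8 / 7).
Proof.
move=> u; rewrite (@loss_on [:: a; b; c]) //.
move: u; rewrite /= !inE negb_or !andbT => /andP[/andP[ab ac] bc].
rewrite /edge_free /= !eqxx /= ?(negPf ab) ?(negPf bc) ?(negPf ac).
rewrite ?(eq_sym b a) ?(eq_sym c a) ?(eq_sym c b) ?(negPf ab) ?(negPf bc) ?(negPf ac) /=.
rewrite mulr_natl -lnXn // ln_div ?posrE //.
by congr (ln _ - ln _); rewrite // -natrX.
Qed.

Lemma loss_flatten_le (I : eqType) (r : seq I) (F : I -> seq (seq nat)) :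
    (forall i, edges_ne (F i)) ->
  loss (flatten [seq F i | i <- r]) <= \sum_(i <- r) loss (F i).
Proof.
move=> ne; elim: r => [|i r IH]; first by rewrite big_nil loss_nil.
rewrite big_cons /=; apply: le_trans (loss_cat _ _) _ => //.
  by apply/negP => /flattenP[_ /mapP[j _ ->]] /(negP (ne j)).
by rewrite lerD2l.
Qed.

Lemma ne_flatten (I : Type) (r : seq I) (F : I -> seq (seq nat)) :
    (forall i, edges_ne (F i)) -> edges_ne (flatten [seq F i | i <- r]).
Proof. by move=> ne; elim: r => //= i r IH; rewrite ne_cat ne. Qed.

Lemma loss_flatten (I : eqType) (r : seq I) (F : I -> seq (seq nat)) :
    (forall i, edges_ne (F i)) -> uniq r ->
    {in r &, forall i j x, x \in flatten (F i) -> x \in flatten (F j) -> i = j} ->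
  loss (flatten [seq F i | i <- r]) = \sum_(i <- r) loss (F i).
Proof.
move=> ne; elim: r => [|i r IH] /=; first by rewrite big_nil loss_nil.
move=> /andP[ir ur] dis; rewrite big_cons /= loss_disjoint ?ne_flatten //.
  rewrite IH // => j k jr kr; apply: dis; rewrite inE ?jr ?kr orbT //.
move=> x xi; apply/negP => /flattenP[e /flattenP[_ /mapP[j jr ->] ej] xe].
have xj : x \in flatten (F j) by apply/flattenP; exists e.
have ij : i = j by apply: dis xi xj; rewrite !inE ?eqxx ?jr ?orbT.
by rewrite ij jr in ir.
Qed.

(** A singleton edge bans its vertex, at a cost of at most [ln 2]. This is the device by which
    integers are given up. *)
Lemma loss_kill s : loss [seq [:: a] | a <- s] <= (size s)%:R * ln 2.
Proof.
elim: s => [|a s IH]; first by rewrite loss_nil mul0r.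
rewrite /= -cat1s; apply: le_trans (loss_cat _ _) _ => //.
  by apply/negP => /mapP[].
by rewrite loss1 -[(size s).+1]add1n natrD mulrDl mul1r lerD2l.
Qed.

End Loss.

(** * The hypergraph of geometric progressions *)

(** Bridge from finite sets to the list recursion: the subsets of [x :: s] are those of [s] and the
    sets [x |: A] with [A] a subset of [s]. *)
Lemma card_cnt (T : finType) (f : T -> nat) (s : seq T) (E : pred (pred nat)) :
    uniq s ->
  #|[set A : {set T} | (A \subset s) && E (fun z => [exists i in A, f i == z])]| =
  cnt [seq f x | x <- s] E.
Proof.
elim: s E => [|x s IH] E /=.
  move=> _; case E0: (E pred0).
    rewrite -[RHS](cards1 (finset.set0 : {set T})); apply: eq_card => A; rewrite !inE.
    apply/andP/eqP => [[/fintype.subsetP A0 _]|->].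
      by apply/finset.setP => z; rewrite inE; apply/negP => /A0.
    split; first by apply/fintype.subsetP => z; rewrite inE.
    have : is_true (E pred0) by rewrite E0.
    congr (E _ : Prop); apply: funext => z; apply/esym/negbTE/existsPn => i.
    by rewrite inE.
  apply: eq_card0 => A; rewrite !inE; apply/negP => /andP[/fintype.subsetP A0].
  have -> : (fun z => [exists i in A, f i == z]) = pred0 :> pred nat.
    apply: funext => z; apply/negbTE/existsPn => i; apply/negP => /andP[/A0].
    by [].
  by rewrite E0.
move=> /andP[xs us]; rewrite -!IH //.
set B := [set A : {set T} | (A \subset s) && E _].
set C := [set A : {set T} | (A \subset s) && E (predU1 _ _)].
have xN (A : {set T}) : A \subset s -> x \notin A.
  by move=> /fintype.subsetP As; apply: contra xs => /As.
have -> : [set A : {set T} | (A \subset x :: s) &&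
    E (fun z => [exists i in A, f i == z])] = B :|: [set x |: A | A in C].
  apply/finset.setP => A; rewrite !inE; apply/andP/orP.
    move=> [/fintype.subsetP sub EA]; case xA: (x \in A); [right|left].
      apply/imsetP; exists (A :\ x)%SET; last by rewrite finset.setD1K.
      rewrite inE; apply/andP; split.
        apply/fintype.subsetP => z; rewrite !inE => /andP[zx /sub].
        by rewrite inE (negPf zx).
      move: EA; congr (E _ : Prop); apply: funext => z; apply/existsP/predU1P.
        move=> [i /andP[iA /eqP <-]]; case: (eqVneq i x) => [->|ix]; first by left.
        by right; apply/existsP; exists i; rewrite !inE ix iA /=.
      move=> [->|/existsP[i /andP[]]]; first by exists x; rewrite xA /=.
      by rewrite !inE => /andP[_ iA] fi; exists i; rewrite iA.
    rewrite EA andbT; apply/fintype.subsetP => z zA; have := sub _ zA.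
    by rewrite inE => /predU1P[zx|//]; rewrite -zx zA in xA.
  move=> [/andP[/fintype.subsetP sub EA]|/imsetP[A' ]].
    by split=> //; apply/fintype.subsetP => z /sub zs; rewrite inE zs orbT.
  rewrite inE => /andP[/fintype.subsetP sub EA] ->; split.
    by apply/fintype.subsetP => z; rewrite !inE => /orP[->//|/sub->]; rewrite orbT.
  move: EA; congr (E _ : Prop); apply: funext => z; apply/predU1P/existsP.
    move=> [->|/existsP[i /andP[iA fi]]].
      by exists x; rewrite !inE eqxx /=.
    by exists i; rewrite !inE iA orbT.
  move=> [i]; rewrite !inE => /andP[/orP[/eqP->|iA] /eqP<-]; first by left.
  by right; apply/existsP; exists i; rewrite iA /=.
rewrite cardsU (_ : B :&: _ = finset.set0) ?cards0 ?subn0.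
  rewrite card_in_imset // => A1 A2; rewrite !inE => /andP[/xN x1 _] /andP[/xN x2 _].
  by move=> e; rewrite -(finset.setU1K x1) e finset.setU1K.
apply/finset.setP => A; rewrite !inE; apply/negP => /andP[/andP[/xN xA _]].
by move=> /imsetP[A' _ AE]; rewrite AE !inE eqxx in xA.
Qed.

Definition gp_edge (t : nat * nat) : seq nat :=
  [:: t.1; t.1 * t.2; t.1 * t.2 ^ 2]%N.

Definition gp (P Q : pred nat) (n : nat) : seq (seq nat) :=
  [seq gp_edge t | t <- [seq (a, r) | a <- iota 1 n, r <- iota 2 n]
     & [&& P t.1, Q t.2 & t.1 * t.2 ^ 2 <= n]%N].

Lemma gpP (P Q : pred nat) n e :
  reflect (exists a r, [/\ [/\ (0 < a)%N, (1 < r)%N & (a * r ^ 2 <= n)%N],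
                           P a, Q r & e = gp_edge (a, r)])
          (e \in gp P Q n).
Proof.
apply: (iffP mapP) => [[[a r]]|[a [r [[a0 r1 arn] Pa Qr ->]]]].
  rewrite mem_filter => /andP[/and3P[Pa Qr arn] /allpairsP[[a' r'] /= [am rm [ea er]]]].
  move: am rm; rewrite -ea -er !mem_iota => /andP[a0 _] /andP[r1 _] ->.
  by exists a, r.
exists (a, r) => //; rewrite mem_filter /= Pa Qr arn; apply/allpairsP.
exists (a, r); rewrite !mem_iota /=; split=> //; nia.
Qed.

Lemma ne_gp P Q n : edges_ne (gp P Q n).
Proof. by apply/negP => /gpP[a [r []]]. Qed.

Lemma gp_vert P Q n x : x \in flatten (gp P Q n) ->
  exists a r j, [/\ [/\ (0 < a)%N, (1 < r)%N & (a * r ^ 2 <= n)%N],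
                   P a, Q r, (j <= 2)%N & x = (a * r ^ j)%N].
Proof.
move=> /flattenP[_ /gpP[a [r [h Pa Qr ->]]]]; rewrite !inE => /or3P[]/eqP->.
- by exists a, r, 0%N; rewrite muln1.
- by exists a, r, 1%N; rewrite expn1.
- by exists a, r, 2%N.
Qed.

Lemma gp_vert_le P Q n x : x \in flatten (gp P Q n) -> (0 < x <= n)%N.
Proof.
move=> /gp_vert[a [r [j [[a0 r1 arn] _ _ j2 ->]]]].
rewrite muln_gt0 a0 expn_gt0 (ltnW r1) /=; apply: leq_trans arn.
by rewrite leq_mul2l leq_exp2l ?j2 ?orbT.
Qed.

Lemma H_cnt n : H n = cnt (iota 1 n) (edge_free (gp predT predT n)).
Proof.
pose s := [seq lift ord0 i | i <- enum 'I_n].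
have us : uniq s by rewrite map_inj_uniq ?enum_uniq //; apply: lift_inj.
have sE : [seq val i | i <- s] = iota 1 n.
  rewrite -map_comp (eq_map (g := S \o val)) //.
  by rewrite map_comp val_enum_ord -[in RHS](addn0 1%N) iotaDl.
rewrite -sE -card_cnt //; apply: eq_card => A; rewrite !inE.
have -> : (A \subset s) = (A \subset [set~ ord0]).
  apply/fintype.subsetP/fintype.subsetP => h z /h; rewrite !inE.
    by move=> /mapP[i _ ->]; rewrite -(inj_eq val_inj).
  case: (unliftP ord0 z) => [j ->|->]; rewrite ?eqxx // => _.
  by apply: map_f; rewrite mem_enum.
congr (_ && _); apply/asboolP/allP => [h e /gpP[a [r [[a0 r1 arn] _ _ ->]]]|h].
  apply/negP => /and4P[/existsP[i /andP[iA /eqP ia]] /existsP[j /andP[jA /eqP ja]]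
    /existsP[k /andP[kA /eqP ka]] _].
  apply: (h i j k iA jA kA); exists r.
  by move: ia ja ka => /= -> -> ->.
move=> a b c aA bA cA [r [a0 r1 bE cE]].
have eL : gp_edge (val a, r) \in gp predT predT n.
  by apply/gpP; exists (val a), r; split=> //; split=> //; rewrite -cE -ltnS.
move: (h _ eL) => /negP; apply; apply/and4P; split=> //; apply/existsP.
- by exists a; rewrite aA /=.
- by exists b; rewrite bA /= -bE.
- by exists c; rewrite cA /= -cE.
Qed.

Lemma H_gt0 n : (0 < H n)%N.
Proof. by rewrite H_cnt cnt_gt0 ?ne_gp. Qed.

Lemma partn_mul_id (pi : nat_pred) s m : pi.-nat s -> pi^'.-nat m ->
  ((m * s)`_pi^' = m)%N.
Proof.
move=> hs hm; have /andP[s0 _] := hs; have /andP[m0 _] := hm.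
by rewrite partnM // part_pnat_id // part_p'nat ?pnatNK // muln1.
Qed.

Section GPLoss.
Variable R : realType.

Definition D (n : nat) : R := loss R (gp predT predT n).
Definition Dpi (pi : nat_pred) (n : nat) : R := loss R (gp predT (pnat pi) n).
Definition dpi (pi : nat_pred) (n : nat) : R := loss R (gp (pnat pi) (pnat pi) n).

Lemma ln_H n : ln (H n)%:R = n%:R * ln 2 - D n :> R.
Proof.
rewrite /D (@loss_on _ (iota 1 n)) ?ne_gp ?iota_uniq //; last first.
  by move=> x /gp_vert_le; rewrite mem_iota add1n ltnS.
by rewrite size_iota H_cnt; ring.
Qed.

Lemma refines_sub L1 L2 : {subset L1 <= L2} -> refines L1 L2.
Proof. by move=> h e eL; exists e => //; exact: h. Qed.

Lemma eq_loss L1 L2 : edges_ne L1 -> L1 =i L2 -> loss R L1 = loss R L2.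
Proof.
move=> ne1 h; have ne2 : edges_ne L2 by rewrite /edges_ne -h.
by apply/eqP; rewrite eq_le !loss_le // => e eL; exists e; rewrite // ?h // -h.
Qed.

(** Multiplication by a [pi]-number leaves the [pi^']-part unchanged, so the terms of such a
    progression share it, and the blocks for distinct [m] have no vertex in common. *)
Lemma Dpi_sum (pi : nat_pred) n :
  Dpi pi n = \sum_(m <- iota 1 n | pi^'.-nat m) dpi pi (n %/ m).
Proof.
rewrite -big_filter.
pose F m := [seq map (muln m) e | e <- gp (pnat pi) (pnat pi) (n %/ m)].
have neF m : edges_ne (F m).
  by apply/negP => /mapP[[|//] h _]; have /negP := @ne_gp (pnat pi) (pnat pi) (n %/ m).
have mem_r m : m \in [seq m <- iota 1 n | pi^'.-nat m] ->
    [/\ (0 < m)%N, (m <= n)%N & pi^'.-nat m].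
  by rewrite mem_filter mem_iota add1n ltnS => /and3P[].
transitivity (\sum_(m <- [seq m <- iota 1 n | pi^'.-nat m]) loss R (F m)); last first.
  apply: eq_big_seq => m /mem_r[m0 _ _]; apply: loss_map; last exact: ne_gp.
  by move=> x y _ _ /eqP; rewrite eqn_pmul2l // => /eqP.
rewrite -loss_flatten ?filter_uniq ?iota_uniq //; last first.
  move=> m k /mem_r[m0 _ hm] /mem_r[k0 _ hk] x.
  have vert l : (0 < l)%N -> pi^'.-nat l -> x \in flatten (F l) -> (x`_pi^' = l)%N.
    move=> l0 hl /flattenP[_ /mapP[e eL ->] /mapP[y ye ->]].
    have /gp_vert[a [r [j [_ ha hr _ ->]]]] : y \in flatten (gp (pnat pi) (pnat pi) (n %/ l)).
      by apply/flattenP; exists e.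
    by rewrite partn_mul_id // pnatM ha pnatX hr.
  by move=> /(vert _ m0 hm) <- /(vert _ k0 hk).
apply: eq_loss; first exact: ne_gp.
move=> e; apply/gpP/flattenP.
  move=> [a [r [[a0 r1 arn] _ hr ->]]].
  have m0 : (0 < a`_pi^')%N by rewrite part_gt0.
  exists (F (a`_pi^')%N).
    apply: map_f; rewrite mem_filter part_pnat mem_iota m0 add1n ltnS /=.
    by apply: leq_trans (dvdn_leq a0 (dvdn_part _ _)) (leq_trans _ arn); nia.
  apply/mapP; exists (gp_edge (a`_pi, r)%N).
    apply/gpP; exists (a`_pi)%N, r; split=> //; last exact: part_pnat.
    by split=> //; rewrite leq_divRL // mulnC mulnA (mulnC (a`_pi^')%N) partnC.
  by rewrite /gp_edge /= !mulnA (mulnC (a`_pi^')%N) partnC.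
move=> [_ /mapP[m /mem_r[m0 mn hm] ->] /mapP[_ /gpP[a [r [[a0 r1 arn] ha hr ->]]] ->]].
exists (m * a)%N, r; split=> //; last by rewrite /gp_edge /= !mulnA.
by split; rewrite ?muln_gt0 ?m0 // -mulnA mulnC -leq_divRL.
Qed.

Lemma D_ge_Dpi pi n : Dpi pi n <= D n.
Proof.
apply: loss_le; rewrite ?ne_gp //; apply: refines_sub => e /gpP[a [r [h _ _ ->]]].
by apply/gpP; exists a, r.
Qed.

(** A ratio that is not a [pi]-number has a prime factor above [y], which forces the first term to
    be at most [n / y ^ 2]. Banning all these first terms destroys every such progression. *)
Lemma D_le_Dpi (pi : nat_pred) y n : (0 < y)%N ->
    (forall p, prime p -> (p <= y)%N -> p \in pi) ->
  D n <= Dpi pi n + (n %/ y ^ 2)%:R * ln 2.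
Proof.
move=> y0 piy.
have nek s : edges_ne [seq [:: a] | a <- s] by apply/negP => /mapP[].
apply: (@le_trans _ _ (loss R (gp predT (pnat pi) n ++
    [seq [:: a] | a <- iota 1 (n %/ y ^ 2)]))).
  apply: loss_le; rewrite ?ne_cat ?ne_gp //=.
  move=> e /gpP[a [r [[a0 r1 arn] _ _ ->]]].
  case hr : (pi.-nat r).
    exists (gp_edge (a, r)) => //; rewrite mem_cat; apply/orP; left.
    by apply/gpP; exists a, r.
  exists [:: a]; last by move=> x; rewrite !inE => ->.
  rewrite mem_cat; apply/orP; right; apply: map_f.
  rewrite mem_iota a0 add1n ltnS leq_divRL ?expn_gt0 ?y0 //=.
  apply: leq_trans arn; rewrite leq_mul2l leq_exp2r //; apply/orP; right.
  rewrite leqNgt; apply/negP => ry; move/negP: hr; apply.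
  apply/pnatP => [|p pp pr]; first exact: ltnW.
  by apply: piy => //; apply: leq_trans (dvdn_leq (ltnW r1) pr) (ltnW ry).
apply: le_trans (loss_cat _ _ _) _; rewrite ?ne_gp //.
by rewrite lerD2l; apply: le_trans (loss_kill _ _) _; rewrite size_iota.
Qed.

(** Increments of the block loss. Summation by parts over them turns a sum over the rounded
    quotients [n %/ m] into counts of rough numbers. *)
Definition eps pi s : R := dpi pi s - dpi pi s.-1.

Lemma eps_ge0 pi s : 0 <= eps pi s.
Proof.
rewrite subr_ge0; apply: loss_le; rewrite ?ne_gp //; apply: refines_sub => e.
move=> /gpP[a [r [[a0 r1 arn] ha hr ->]]]; apply/gpP; exists a, r; split=> //.
by split=> //; apply: leq_trans arn (leq_pred _).
Qed.

Lemma eps_notin (pi : nat_pred) s : ~~ pi.-nat s -> eps pi s = 0.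
Proof.
move=> hs; apply/eqP; rewrite subr_eq0; apply/eqP; apply: eq_loss; rewrite ?ne_gp //.
move=> e; apply/gpP/gpP => -[a [r [[a0 r1 arn] ha hr ->]]]; exists a, r; split=> //;
  split=> //.
  have : (a * r ^ 2 != s)%N.
    by apply: contra hs => /eqP<-; rewrite pnatM ha pnatX hr.
  by rewrite -ltnS; case: s {hs} arn => [|s] //; lia.
by apply: leq_trans arn (leq_pred _).
Qed.

(** Every progression that appears at [s] has last term [s], so banning [s] alone takes care of all
    of them. *)
Lemma eps_le pi s : eps pi s <= ln 2.
Proof.
rewrite lerBlDr addrC -[X in _ <= _ + X](@loss1 R s).
apply: le_trans (loss_cat _ _ _); rewrite ?ne_gp //.
apply: loss_le; rewrite ?ne_cat ?ne_gp //.
move=> e /gpP[a [r [[a0 r1 arn] ha hr ->]]].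
case: (eqVneq (a * r ^ 2) s)%N => [<-|ne].
  exists [:: a * r ^ 2]%N; first by rewrite mem_cat inE eqxx orbT.
  by move=> x; rewrite !inE => /eqP->; rewrite eqxx !orbT.
exists (gp_edge (a, r)) => //; rewrite mem_cat; apply/orP; left; apply/gpP.
exists a, r; split=> //; split=> //.
by case: s arn ne => [|s]; lia.
Qed.

Lemma dpi0 pi : dpi pi 0 = 0.
Proof. exact: loss_nil. Qed.

Lemma dpi_sum pi n : dpi pi n = \sum_(s <- iota 1 n) eps pi s.
Proof.
elim: n => [|n IH]; first by rewrite big_nil dpi0.
by rewrite -[n.+1]addn1 iotaD big_cat /= -IH big_cons big_nil /eps add1n addn1 /=; ring.
Qed.

(** Legendre's sieve function, counting the integers up to [n] without prime factors in [pi]. *)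
Definition Phi (pi : nat_pred) n := count (pnat pi^') (iota 1 n).

Lemma Phi_divn (pi : nat_pred) n s : (0 < s)%N ->
  count (fun m => pi^'.-nat m && (s * m <= n))%N (iota 1 n) = Phi pi (n %/ s).
Proof.
move=> s0; rewrite /Phi -!size_filter.
have -> : iota 1 n = iota 1 (n %/ s) ++ iota (1 + n %/ s) (n - n %/ s).
  by rewrite -iotaD subnKC // leq_div.
rewrite filter_cat (eq_in_filter (a2 := pnat pi^')); last first.
  move=> m; rewrite mem_iota add1n ltnS => /andP[m0 hm].
  by rewrite mulnC -leq_divRL // hm andbT.
rewrite [X in _ ++ X](eq_in_filter (a2 := pred0)) ?filter_pred0 ?cats0 //.
move=> m; rewrite mem_iota => /andP[h _] /=.
by rewrite mulnC -leq_divRL // leqNgt -add1n h andbF.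
Qed.

(** Exchange of summation: the block of [m] contains the increment at [s] exactly when [s * m <= n].
    The terms with [s > n] vanish, so one [X] can serve two values of [n]. *)
Lemma Dpi_eps (pi : nat_pred) n X : (n <= X)%N ->
  Dpi pi n = \sum_(s <- iota 1 X) eps pi s * (Phi pi (n %/ s))%:R.
Proof.
move=> nX; rewrite Dpi_sum.
transitivity (\sum_(m <- iota 1 n | pi^'.-nat m) \sum_(s <- iota 1 X | (s * m <= n)%N)
    eps pi s).
  rewrite big_seq_cond [RHS]big_seq_cond.
  apply: eq_bigr => m /andP[]; rewrite mem_iota => /andP[m0 _] _.
  rewrite dpi_sum -[RHS]big_filter; congr (\sum_(s <- _) _).
  rewrite (eq_filter (a2 := fun s => s <= n %/ m)%N); last first.
    by move=> s /=; rewrite leq_divRL.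
  have le : (n %/ m <= X)%N by apply: leq_trans nX; exact: leq_div.
  rewrite -(subnKC le) iotaD filter_cat.
  rewrite (eq_in_filter (a2 := predT)) ?filter_predT; last first.
    by move=> s; rewrite mem_iota add1n ltnS => /andP[_ ->].
  rewrite (eq_in_filter (a2 := pred0)) ?filter_pred0 ?cats0 //.
  by move=> s; rewrite mem_iota => /andP[h _]; rewrite /= leqNgt -add1n h.
rewrite (exchange_big_dep predT) //=; apply: eq_big_seq => s.
rewrite mem_iota => /andP[s0 _].
rewrite -big_filter big_const_seq count_predT iter_addr_0 mulr_natr; congr (_ *+ _).
by rewrite -Phi_divn // -size_filter.
Qed.

End GPLoss.

(** * The sieve *)

Definition pset (ps : seq nat) : nat_pred := [pred p | p \in ps].

Lemma filter_dvdn_iota p N : (0 < p)%N ->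
  perm_eq [seq m <- iota 1 N | (p %| m)%N] [seq (p * k)%N | k <- iota 1 (N %/ p)].
Proof.
move=> p0; apply: uniq_perm.
- by rewrite filter_uniq // iota_uniq.
- by rewrite map_inj_uniq ?iota_uniq // => x y /eqP; rewrite eqn_pmul2l // => /eqP.
move=> m; rewrite mem_filter mem_iota add1n ltnS; apply/idP/mapP.
  move=> /and3P[/dvdnP[k ->] m0 mN]; exists k; last by rewrite mulnC.
  by rewrite mem_iota add1n ltnS leq_divRL // mN andbT; case: k m0 {mN}.
move=> [k]; rewrite mem_iota add1n ltnS leq_divRL // => /andP[k0 kN] ->.
by rewrite dvdn_mulr //= muln_gt0 p0 k0 mulnC.
Qed.

Lemma pnat_cons_coprime p ps m : prime p -> (0 < m)%N ->
  (pset (p :: ps))^'.-nat m = ((pset ps)^'.-nat m && ~~ (p %| m)%N).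
Proof.
move=> pp m0; apply/pnatP/andP => // [h|[/pnatP h pm] q qp qm].
  split; last by apply/negP => pm; have := h p pp pm; rewrite !inE eqxx.
  by apply/pnatP => // q qp qm; have := h q qp qm; rewrite !inE negb_or => /andP[].
have := h m0 q qp qm; rewrite !inE negb_or => ->; rewrite andbT.
by apply: contra pm => /eqP<-.
Qed.

Lemma pnat_cons_ndvd p ps m : prime p -> ~~ (p %| m)%N ->
  (pset (p :: ps)).-nat m -> (pset ps).-nat m.
Proof.
move=> pp pm /andP[m0 /allP h]; apply/pnatP => // q qp qm.
have := h q; rewrite mem_primes qp m0 qm => /(_ isT); rewrite !inE => /predU1P[qE|//].
by rewrite -qE qm in pm.
Qed.

Lemma count_split (T : Type) (P Q : pred T) s :
  count P s = (count (fun x => P x && ~~ Q x) s + count P [seq x <- s | Q x])%N.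
Proof.
by elim: s => //= x s ->; case: (Q x) => /=; case: (P x) => /=; lia.
Qed.

(** Legendre's recursion: as [p] is not in [ps], a multiple [p * k] is rough for [ps] exactly when
    [k] is. *)
Lemma Phi_cons p ps N : prime p -> p \notin ps ->
  (Phi (pset (p :: ps)) N + Phi (pset ps) (N %/ p) = Phi (pset ps) N)%N.
Proof.
move=> pp pps; have p0 := prime_gt0 pp.
rewrite /Phi [RHS](count_split _ (dvdn p)); congr addn.
  apply: eq_in_count => m; rewrite mem_iota => /andP[m0 _].
  exact: pnat_cons_coprime.
rewrite (permP (filter_dvdn_iota N p0)) count_map; apply: eq_count => k /=.
by rewrite pnatM (pnatE _ pp) !inE pps.
Qed.

Section Sieve.
Variable R : realType.
Implicit Types (ps : seq nat) (al : R).

Definition rough_density ps : R := \prod_(p <- ps) (1 - p%:R^-1).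

Lemma powR_div (x y al : R) : 0 <= x -> 0 <= y ->
  (x / y) `^ al = x `^ al * y `^ (- al).
Proof.
move=> x0 y0; rewrite powRM ?invr_ge0 //; congr (_ * _).
by rewrite -powR_inv1 // -powRrM mulN1r.
Qed.

(** With [x = n / d]: if [x >= 1], the fractional part is below [1 <= x ^ al]; if [x < 1], it is [x]
    itself, and [x <= x ^ al]. *)
Lemma floor_powR (n d : nat) al : (0 < d)%N -> 0 < al <= 1 ->
  `|(n %/ d)%:R - n%:R / d%:R| <= (n%:R / d%:R) `^ al.
Proof.
move=> d0 /andP[a0 a1]; have dR : 0 < d%:R :> R by rewrite ltr0n.
have := divn_eq n d; set q := (n %/ d)%N => nE.
have rd : (n %% d < d)%N by rewrite ltn_mod.
have -> : n%:R / d%:R = q%:R + (n %% d)%:R / d%:R :> R.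
  by rewrite {1}nE natrD natrM mulrDl mulfK // gt_eqF.
set t := (n %% d)%:R / d%:R.
have t0 : 0 <= t by rewrite divr_ge0.
have t1 : t < 1 by rewrite ltr_pdivrMr // mul1r ltr_nat.
rewrite opprD addNKr normrN ger0_norm //.
case: (posnP q) => [->|q0].
  rewrite add0r; case: (ltgtP t 0) t0 => // [tp _|-> _]; last by rewrite powR_ge0.
  by apply: ger1_powR => //; rewrite tp ltW.
apply: le_trans (ltW t1) _.
have le1 : 1 <= q%:R + t by apply: le_trans (_ : q%:R <= _); rewrite ?ler1n // lerDl.
by have := ler_powR le1 (ltW a0); rewrite powRr0.
Qed.

(* Legendre's sieve with Rankin's trick: the error [x - floor x <= x ^ al] is
   propagated through [Phi_cons]. *)
Lemma Phi_bound ps al : {in ps, forall p, prime p} -> uniq ps -> 0 < al <= 1 ->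
  forall n d : nat, (0 < d)%N ->
  `|(Phi (pset ps) (n %/ d))%:R - n%:R / d%:R * rough_density ps| <=
  (n%:R / d%:R) `^ al * \prod_(p <- ps) (1 + p%:R `^ (- al)).
Proof.
move=> + + hal; elim: ps => [|p ps IH] pps ups n d d0.
  rewrite /rough_density !big_nil !mulr1 (_ : Phi _ _ = n %/ d)%N ?floor_powR //.
  rewrite /Phi -[RHS](size_iota 1) -[RHS]count_predT; apply: eq_in_count => m.
  by rewrite mem_iota => /andP[m0 _]; apply/pnatP.
have pp : prime p by apply: pps; rewrite mem_head.
have pps' : {in ps, forall q, prime q} by move=> q qs; apply: pps; rewrite inE qs orbT.
move: ups => /= /andP[pN ups].
have p0 : (0 < p)%N by exact: prime_gt0.
have pR : 0 < p%:R :> R by rewrite ltr0n.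
have dR : 0 < d%:R :> R by rewrite ltr0n.
have dp0 : (0 < d * p)%N by rewrite muln_gt0 d0.
have h1 := IH pps' ups n d d0; have h2 := IH pps' ups n (d * p)%N dp0.
have <- : (Phi (pset ps) (n %/ d))%:R - (Phi (pset ps) (n %/ (d * p)))%:R =
    (Phi (pset (p :: ps)) (n %/ d))%:R :> R.
  by rewrite -(Phi_cons (n %/ d) pp pN) natrD divnMA addrK.
rewrite /rough_density !big_cons -/(rough_density ps) in h1 h2 *.
set P := \prod_(q <- ps) (1 + q%:R `^ (- al)) in h1 h2 *.
have e : n%:R / (d * p)%:R = n%:R / d%:R * p%:R^-1 :> R.
  by rewrite natrM invfM mulrA.
rewrite e in h2.
have powE : (n%:R / d%:R * p%:R^-1) `^ al = (n%:R / d%:R) `^ al * p%:R `^ (- al).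
  by rewrite powR_div ?divr_ge0.
rewrite powE in h2.
rewrite (_ : _ - _ - _ = ((Phi (pset ps) (n %/ d))%:R - n%:R / d%:R * rough_density ps)
  - ((Phi (pset ps) (n %/ (d * p)))%:R - n%:R / d%:R / p%:R * rough_density ps));
  last by ring.
apply: le_trans (ler_normB _ _) _; apply: le_trans (lerD h1 h2) _.
by rewrite le_eqVlt; apply/orP; left; apply/eqP; ring.
Qed.

(** Finite form of an Euler product: if [S] is the sum and [x = p ^ (- al)], the multiples of [p]
    contribute at most [x * S], hence [S * (1 - x)] is bounded by the sum for [ps] without [p]. *)
Lemma smooth_sum ps al X : {in ps, forall p, prime p} -> 0 < al ->
  \sum_(s <- iota 1 X | (pset ps).-nat s) (s%:R `^ (- al)) <=
  \prod_(p <- ps) (1 - p%:R `^ (- al))^-1 :> R.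
Proof.
move=> + a0; elim: ps X => [|p ps IH] X pps.
  rewrite big_nil; case: X => [|X]; first by rewrite big_nil.
  rewrite -[iota 1 X.+1]/(1%N :: iota 2 X) big_cons (_ : pnat _ 1 = true) //.
  rewrite big_seq_cond big1 ?addr0.
    by rewrite powR1.
  move=> s; rewrite mem_iota => /andP[/andP[s1 _] /pnatP hs].
  have [p pp ps] : exists2 p, prime p & (p %| s)%N.
    by exists (pdiv s); rewrite ?pdiv_prime ?pdiv_dvd.
  by have := hs (ltnW s1) p pp ps.
have pp : prime p by apply: pps; rewrite mem_head.
have pps' : {in ps, forall q, prime q} by move=> q qs; apply: pps; rewrite inE qs orbT.
have p0 : (0 < p)%N by exact: prime_gt0.
have x1 : p%:R `^ (- al) < 1 :> R.
  rewrite powRN invf_lt1 ?powR_gt0 ?ltr0n //.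
  have : 0 < al * ln p%:R by rewrite mulr_gt0 // ln_gt0 // ltr1n prime_gt1.
  by rewrite /powR gt_eqF ?ltr0n // expR_gt1.
have {}IH := IH X pps'.
rewrite big_cons; set x := p%:R `^ (- al) in x1 *.
rewrite [leRHS]mulrC ler_pdivlMr ?subr_gt0 //.
apply: le_trans IH; set S := \sum_(_ <- _ | _) _.
rewrite mulrBr mulr1 lerBlDr.
rewrite {1}/S (bigID (fun s => (p %| s)%N)) /= addrC; apply: lerD.
  rewrite big_mkcond [leRHS]big_mkcond; apply: ler_sum => s _.
  case: ifP => [/andP[hs ps_]|_]; last by case: ifP => // _; rewrite powR_ge0.
  by rewrite (pnat_cons_ndvd pp ps_ hs).
rewrite (eq_bigl (fun s => (p %| s)%N && (pset (p :: ps)).-nat s)); last first.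
  by move=> s; rewrite andbC.
rewrite -big_filter_cond (perm_big _ (filter_dvdn_iota X p0)) big_map /=.
have le : (X %/ p <= X)%N by apply: leq_div.
rewrite /S -[in leRHS](subnKC le) iotaD big_cat mulrDl ler_wpDr //.
  by rewrite mulr_ge0 ?powR_ge0 // sumr_ge0 // => s _; rewrite powR_ge0.
rewrite mulr_suml big_mkcond [leRHS]big_mkcond; apply: ler_sum => k _.
rewrite pnatM (pnatE _ pp) !inE eqxx /=.
by case: ifP => // _; rewrite natrM powRM ?ler0n // mulrC.
Qed.

(* [5 x] dominates [ln ((1 + x) / (1 - x))] for [x <= 3 / 4]; the bound
   [x <= 3 / 4] follows from [al >= 1 / 2]. *)
Lemma sieve_prod_le ps al : {in ps, forall p, prime p} -> 1 / 2 <= al ->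
  (\prod_(p <- ps) (1 + p%:R `^ (- al))) *
  (\prod_(p <- ps) (1 - p%:R `^ (- al))^-1) <=
  expR (5 * \sum_(p <- ps) p%:R `^ (- al)) :> R.
Proof.
move=> + al2; elim: ps => [|p ps IH] pps.
  by rewrite !big_nil mulr0 expR0 mulr1.
have p2 : (1 < p)%N by apply: prime_gt1; apply: pps; rewrite mem_head.
have {}IH := IH (fun q qs => pps q (mem_behead (s := p :: ps) qs)).
rewrite !big_cons mulrDr expRD mulrACA; set x := p%:R `^ (- al).
have x0 : 0 <= x by rewrite powR_ge0.
have x34 : x <= 3 / 4.
  apply: (@le_trans _ _ (2 `^ (- (1 / 2)))).
    rewrite /x !powRN lef_pV2 ?posrE ?powR_gt0 ?ltr0n ?(ltnW p2) //.
    apply: (@le_trans _ _ (2 `^ al)); first by rewrite ler_powR // ler1n.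
    by rewrite ge0_ler_powR ?nnegrE ?ler_nat //; apply: le_trans al2; lra.
  rewrite powRN mul1r powR12_sqrt // invf_ple ?posrE ?sqrtr_gt0 //.
  by rewrite -[leLHS]ger0_norm ?invr_ge0 // -sqrtr_sqr ler_wsqrtr //; lra.
apply: ler_pM => //.
- by rewrite mulr_ge0 ?invr_ge0 //; lra.
- apply: mulr_ge0; first by apply: prodr_ge0 => q _; rewrite addr_ge0 ?powR_ge0.
  rewrite big_seq; apply: prodr_ge0 => q qs; rewrite invr_ge0 subr_ge0 powRN.
  have q1 : (0 < q)%N by rewrite prime_gt0 // pps // inE qs orbT.
  have q1R : 1 <= q%:R :> R by rewrite ler1n.
  have al0 : 0 <= al by lra.
  by rewrite invf_le1 ?powR_gt0 ?ltr0n //; have := ler_powR q1R al0; rewrite powRr0.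
rewrite (_ : 5 * x = x + 4 * x); last by ring.
rewrite expRD; apply: ler_pM; [lra|rewrite invr_ge0; lra|exact: expR_ge1Dx|].
rewrite (_ : (1 - x)^-1 = 1 + x / (1 - x)); last by field; lra.
apply: le_trans (expR_ge1Dx _) _; rewrite ler_expR ler_pdivrMr; nra.
Qed.

(** Each [Phi] in [Dpi_eps] is replaced by its main term. The increments are at most [ln 2] and
    vanish off the smooth numbers, so the errors add up to the two products of [sieve_prod_le]. *)
Lemma Dpi_bound ps al n X : {in ps, forall p, prime p} -> uniq ps ->
    1 / 2 <= al -> al <= 1 -> (n <= X)%N ->
  `|Dpi R (pset ps) n - n%:R * (rough_density ps *
     \sum_(s <- iota 1 X) eps R (pset ps) s / s%:R)| <=
  ln 2 * n%:R `^ al * expR (5 * \sum_(p <- ps) p%:R `^ (- al)).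
Proof.
move=> pps ups al2 al1 nX; rewrite (Dpi_eps _ _ nX).
have al0 : 0 < al <= 1 by rewrite al1 andbT; lra.
have l2 : 0 <= ln 2 :> R by rewrite ln_ge0 // ler1n.
set B := expR _; rewrite !mulr_sumr -sumrB.
set P := \prod_(p <- ps) (1 + p%:R `^ (- al)).
have P0 : 0 <= P by rewrite prodr_ge0 // => q _; rewrite addr_ge0 ?powR_ge0.
apply: le_trans (ler_norm_sum _ _ _) _.
apply: (@le_trans _ _ (\sum_(s <- iota 1 X | (pset ps).-nat s)
    ln 2 * (n%:R `^ al * s%:R `^ (- al) * P))).
  rewrite [leRHS]big_mkcond big_seq [leRHS]big_seq.
  apply: ler_sum => s; rewrite mem_iota => /andP[s0 _].
  case hs : ((pset ps).-nat s); last first.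
    by rewrite eps_notin ?hs // !mul0r !mulr0 subr0 normr0.
  have -> : n%:R `^ al * s%:R `^ (- al) = (n%:R / s%:R) `^ al :> R.
    by rewrite powR_div.
  rewrite (_ : _ - _ = eps R (pset ps) s * ((Phi (pset ps) (n %/ s))%:R -
    n%:R / s%:R * rough_density ps)); last by ring.
  rewrite normrM ger0_norm ?eps_ge0 //.
  by apply: ler_pM; rewrite ?eps_ge0 ?eps_le ?Phi_bound.
rewrite -mulr_sumr -mulrA ler_wpM2l // -mulr_suml -mulr_sumr -mulrA.
rewrite ler_wpM2l ?powR_ge0 // /B; apply: le_trans _ (sieve_prod_le pps al2).
rewrite mulrC ler_wpM2l //; apply: smooth_sum => //; lra.
Qed.

(** Both ratios are close to the same density, truncated at [n']; no infinite series has to be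
    summed. *)
Lemma Dpi_ratio ps al (n n' : nat) : {in ps, forall p, prime p} -> uniq ps ->
    1 / 2 <= al -> al <= 1 -> (0 < n)%N -> (n <= n')%N ->
  `|Dpi R (pset ps) n / n%:R - Dpi R (pset ps) n' / n'%:R| <=
  2 * ln 2 * n%:R `^ (al - 1) * expR (5 * \sum_(p <- ps) p%:R `^ (- al)).
Proof.
move=> pps ups al2 al1 n0 nn'; have n'0 : (0 < n')%N by apply: leq_trans nn'.
have l2 : 0 <= ln 2 :> R by rewrite ln_ge0 // ler1n.
have main (m : nat) : (n <= m)%N -> (m <= n')%N -> forall C,
    C = rough_density ps * \sum_(s <- iota 1 n') eps R (pset ps) s / s%:R ->
    `|Dpi R (pset ps) m / m%:R - C| <=
    ln 2 * n%:R `^ (al - 1) * expR (5 * \sum_(p <- ps) p%:R `^ (- al)).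
  move=> nm mn' C ->; have mN : (0 < m)%N by apply: leq_trans nm.
  have m0 : 0 < m%:R :> R by rewrite ltr0n.
  set A := rough_density ps * _; set B := expR _.
  rewrite (_ : _ - A = (Dpi R (pset ps) m - m%:R * A) / m%:R); last by field; lra.
  rewrite normrM [X in _ * X]ger0_norm ?invr_ge0 ?(ltW m0) // ler_pdivrMr //.
  apply: le_trans (Dpi_bound pps ups al2 al1 mn') _.
  rewrite -!mulrA ler_wpM2l // -/B [leLHS]mulrC [leRHS]mulrCA ler_wpM2l ?expR_ge0 //.
  have al0 : 0 < al by lra.
  rewrite -(mulr_powRB1 (ltW m0) al0) mulrC ler_wpM2r ?(ltW m0) //.
  rewrite -[al - 1]opprB !powRN lef_pV2 ?posrE ?powR_gt0 ?ltr0n //.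
  by rewrite ge0_ler_powR ?nnegrE ?ler_nat //; lra.
have h1 := main n (leqnn n) nn' _ erefl; have h2 := main n' nn' (leqnn n') _ erefl.
apply: le_trans (ler_distD (rough_density ps *
  \sum_(s <- iota 1 n') eps R (pset ps) s / s%:R) _ _) _.
rewrite [X in _ + X <= _]distrC; apply: le_trans (lerD h1 h2) _.
by rewrite le_eqVlt; apply/orP; left; apply/eqP; ring.
Qed.

End Sieve.

(** * Primes in dyadic intervals *)

Lemma bin_le_exp2 n k : ('C(n, k) <= 2 ^ n)%N.
Proof.
elim: n k => [|n IH] [|k] //; first by rewrite bin0 expn_gt0.
by rewrite binS expnS mul2n -addnn leq_add.
Qed.

Lemma dvd_prod_primes (s : seq nat) N : {in s, forall p, prime p} -> uniq s ->
  {in s, forall p, p %| N}%N -> (\prod_(p <- s) p %| N)%N.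
Proof.
elim: s => [|p s IH] hp /= us hN; first by rewrite big_nil dvd1n.
move: us => /andP[ps us]; rewrite big_cons.
have pp : prime p by apply: hp; rewrite mem_head.
have hp' : {in s, forall q, prime q} by move=> q qs; apply: hp; rewrite inE qs orbT.
have hN' : {in s, forall q, q %| N}%N by move=> q qs; apply: hN; rewrite inE qs orbT.
rewrite Gauss_dvd ?(hN p) ?mem_head ?IH //.
rewrite prime_coprime // big_seq; elim/big_ind: _ => [|a b ha hb|q qs].
- by rewrite gtnNdvd // prime_gt1.
- by rewrite Euclid_dvdM // negb_or ha.
apply/negP; rewrite (dvdn_prime2 pp (hp' _ qs)) => /eqP pq.
by rewrite pq qs in ps.
Qed.

Lemma prime_dvd_factorial p n : prime p -> (p %| n`!)%N -> (p <= n)%N.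
Proof.
move=> pp; elim: n => [|n IH]; first by rewrite dvdn1 => /eqP p1; rewrite p1 in pp.
rewrite factS Euclid_dvdM // => /orP[|/IH]; last exact: leqW.
exact: dvdn_leq.
Qed.

Definition primes_upto N := [seq p <- iota 1 N | prime p].

Definition primes_dyadic j := [seq p <- iota (1 + 2 ^ j) (2 ^ j) | prime p].

Lemma primes_uptoS j :
  primes_upto (2 ^ j.+1) = primes_upto (2 ^ j) ++ primes_dyadic j.
Proof. by rewrite /primes_upto expnS mul2n -addnn iotaD filter_cat. Qed.

Lemma mem_primes_dyadic j p :
  (p \in primes_dyadic j) = [&& prime p, (2 ^ j < p)%N & (p <= 2 ^ j.+1)%N].
Proof.
by rewrite mem_filter mem_iota add1n expnS mul2n -addnn addSn ltnS.
Qed.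

(* Chebyshev: the primes in [(2 ^ j, 2 ^ (j + 1)]] all divide a central binomial
   coefficient. *)
Lemma size_primes_dyadic j : (size (primes_dyadic j) * j <= 2 ^ j.+1)%N.
Proof.
set s := primes_dyadic j; set N := 'C(2 ^ j.+1, 2 ^ j).
have le : (2 ^ j <= 2 ^ j.+1)%N by rewrite leq_exp2l.
have N0 : (0 < N)%N by rewrite bin_gt0.
have sp : {in s, forall p, prime p} by move=> p; rewrite mem_primes_dyadic => /and3P[].
have dv : (\prod_(p <- s) p %| N)%N.
  apply: dvd_prod_primes => //; first by rewrite filter_uniq ?iota_uniq.
  move=> p; rewrite mem_primes_dyadic => /and3P[pp p1 p2].
  have : (p %| (2 ^ j.+1)`!)%N by apply: dvdn_fact; rewrite prime_gt0.
  rewrite -(bin_fact le) expnS mul2n -addnn addnK Euclid_dvdM // => /orP[|].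
    by rewrite addnn -mul2n -expnS.
  by rewrite Euclid_dvdM // orbb => /(prime_dvd_factorial pp); rewrite leqNgt p1.
have := leq_trans (dvdn_leq N0 dv) (bin_le_exp2 _ _).
have : (2 ^ (size s * j) <= \prod_(p <- s) p)%N.
  have : {in s, forall p, 2 ^ j <= p}%N.
    by move=> p; rewrite mem_primes_dyadic => /and3P[_ /ltnW].
  rewrite mulnC expnM; elim: (s) => [|p t IH] h; first by rewrite big_nil.
  rewrite big_cons expnS leq_mul ?h ?mem_head // IH // => q qt.
  by apply: h; rewrite inE qt orbT.
by move=> h1 h2; have := leq_trans h1 h2; rewrite leq_exp2l.
Qed.

(** By Chebyshev the block [j] contributes at most [2 / j]. Comparing this with
    [8 * (sqrt (j + 1) - sqrt j)] gives a bound cruder than a logarithm, but good enough for the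
    error term. *)
Lemma sum_inv_primes (R : realType) J :
  \sum_(p <- primes_upto (2 ^ J)) (p%:R^-1) <= 8 * Num.sqrt J%:R :> R.
Proof.
elim: J => [|J IH]; first by rewrite /primes_upto /= big_nil sqrtr0 mulr0.
rewrite primes_uptoS big_cat /=.
case: J => [|J] in IH *.
  rewrite /primes_upto /primes_dyadic /= big_nil add0r big_cons big_nil.
  rewrite sqrtr1 expn0 addr0 mulr1; apply: (@le_trans _ _ 1); last by lra.
  by rewrite invf_le1 ?ler1n ?ltr0n.
set j := J.+1 in IH *; have j0 : 0 < j%:R :> R by rewrite ltr0n.
have j1 : 1 <= j%:R :> R by rewrite ler1n.
have block : \sum_(p <- primes_dyadic j) (p%:R^-1) <= 2 / j%:R :> R.
  have e0 : 0 < (2 ^ j)%:R :> R by rewrite ltr0n expn_gt0.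
  apply: (@le_trans _ _ ((size (primes_dyadic j))%:R / (2 ^ j)%:R)).
    rewrite mulr_natl -iter_addr_0 -[size _]count_predT -big_const_seq.
    rewrite big_seq [leRHS]big_seq.
    apply: ler_sum => p; rewrite mem_primes_dyadic => /and3P[pp /ltnW p1 _].
    by rewrite lef_pV2 ?posrE ?ler_nat // ltr0n prime_gt0.
  rewrite ler_pdivrMr // mulrAC ler_pdivlMr // -!natrM ler_nat -expnS.
  exact: size_primes_dyadic.
apply: le_trans (lerD IH block) _.
rewrite -[j.+1]addn1 natrD.
set a := Num.sqrt j%:R; set b := Num.sqrt (j%:R + 1).
have a2 : a ^+ 2 = j%:R by rewrite sqr_sqrtr // ltW.
have b2 : b ^+ 2 = j%:R + 1 by rewrite sqr_sqrtr // addr_ge0 // ltW.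
have a0 : 0 < a by rewrite sqrtr_gt0.
have b0 : 0 < b by rewrite sqrtr_gt0; lra.
rewrite -a2 in j0 j1 b2 *.
have a1 : 1 <= a by rewrite -(@ler_pXn2r _ 2) ?nnegrE ?expr1n // ltW.
have b1 : 1 <= b by rewrite -(@ler_pXn2r _ 2) ?nnegrE ?expr1n ?b2 ?(ltW b0) //; lra.
have ab : b + a <= 3 * a ^+ 2 by nra.
rewrite -lerBrDl ler_pdivrMr //.
have diff : (b - a) * (b + a) = 1 by rewrite -subr_sqr; lra.
have dba : 0 <= b - a by nra.
by have := ler_wpM2l dba ab; rewrite diff; lra.
Qed.

(** * Existence of the limit *)

Section Limit.
Variable R : realType.

Definition subexp (n : nat) : R := Num.sqrt (ln n%:R * ln (ln n%:R)).

Lemma ln2_ge_half : 1 / 2 <= ln 2 :> R.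
Proof.
rewrite -ler_expR lnK ?posrE // -[1 / 2]opprK expRN.
rewrite invf_ple ?posrE ?expR_gt0 //; apply: le_trans _ (expR_ge1Dx _).
by lra.
Qed.

Lemma ln2_le1 : ln 2 <= 1 :> R.
Proof.
rewrite -ler_expR lnK ?posrE //; apply: le_trans _ (expR_ge1Dx _).
by lra.
Qed.

Lemma D_Dpi_dist (y n : nat) (ps : seq nat) : (0 < y)%N -> (0 < n)%N ->
    (forall p, prime p -> (p <= y)%N -> p \in ps) ->
  `|D R n / n%:R - Dpi R (pset ps) n / n%:R| <= ln 2 / y%:R ^+ 2.
Proof.
move=> y0 n0 yps; have nR : 0 < n%:R :> R by rewrite ltr0n.
have yR : 0 < y%:R :> R by rewrite ltr0n.
have l2 := ln2_ge_half.
rewrite -mulrBl ger0_norm; last first.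
  by rewrite divr_ge0 ?subr_ge0 ?D_ge_Dpi // ltW.
rewrite ler_pdivrMr // lerBlDl.
apply: le_trans (D_le_Dpi R n y0 (pi := pset ps) _) _ => [p pp py|].
  by rewrite inE yps.
rewrite lerD2l mulrC -mulrA ler_wpM2l //; first by lra.
rewrite mulrC ler_pdivlMr ?exprn_gt0 // -natrX -natrM ler_nat.
exact: leq_divM.
Qed.

(** The factor [p ^ eta <= 2 ^ (J * eta)] is pulled out, which leaves the sum of reciprocals. *)
Lemma sum_primes_powR (J : nat) (eta : R) : 0 <= eta ->
  \sum_(p <- primes_upto (2 ^ J)) (p%:R `^ (- (1 - eta))) <=
  expR (eta * (J%:R * ln 2)) * (8 * Num.sqrt J%:R) :> R.
Proof.
move=> e0; apply: (@le_trans _ _ (\sum_(p <- primes_upto (2 ^ J))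
    expR (eta * (J%:R * ln 2)) * p%:R^-1)).
  rewrite big_seq [leRHS]big_seq; apply: ler_sum => p.
  rewrite mem_filter mem_iota add1n ltnS => /and3P[_ p0 pJ].
  have pR : 0 < p%:R :> R by rewrite ltr0n.
  rewrite opprB powRD; last by rewrite (gt_eqF pR) implybT.
  rewrite powR_inv1 ?(ltW pR) // ler_wpM2r ?invr_ge0 ?(ltW pR) //.
  rewrite /powR (gt_eqF pR) ler_expR ler_wpM2l // mulr_natl -lnXn //.
  by rewrite ler_ln ?posrE ?exprn_gt0 // -natrX ler_nat.
by rewrite -mulr_sumr ler_wpM2l ?expR_ge0 // sum_inv_primes.
Qed.

Lemma D_ratio_dist : exists n0 : nat, forall n n' : nat, (n0 <= n)%N -> (n <= n')%N ->
  [/\ 1 <= ln n%:R :> R, 1 <= ln (ln n%:R) :> R &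
  `|D R n / n%:R - D R n' / n'%:R| <= 10 * ln 2 * expR (- (subexp n / 2))].
Proof.
(* The end of [hsum] requires [d >= 80] for [d = (ln (ln n)) ^ (1 / 4)], whence the threshold
   [ln (ln n) >= K ^ 4]. An abstract [K] prevents the evaluation of its powers. *)
have [K K80] : exists K : R, 80 <= K by exists 80.
have K2 : 4 <= K ^+ 2 by nra.
have K4 : 1 <= K ^+ 4 by rewrite exprn_ege1 //; lra.
pose N0 : R := expR (expR (K ^+ 4)).
have N00 : 0 < N0 by exact: expR_gt0.
exists (Num.truncn N0).+1 => n n' n0n nn'.
have nN0 : N0 <= n%:R.
  apply: le_trans (_ : (Num.truncn N0).+1%:R <= _); last by rewrite ler_nat.
  exact: ltW (truncnS_gt _).
have nR : 0 < n%:R :> R by exact: lt_le_trans nN0.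
have n0 : (0 < n)%N by rewrite -(ltr0n R).
have Lge : expR (K ^+ 4) <= ln n%:R :> R.
  by rewrite -[leLHS]expRK ler_ln ?posrE.
set L := ln n%:R in Lge *.
have L0 : 0 < L by apply: lt_le_trans Lge; exact: expR_gt0.
have LLge : K ^+ 4 <= ln L.
  by rewrite -[leLHS]expRK ler_ln ?posrE ?expR_gt0.
have LL0 : 0 < ln L by apply: lt_le_trans LLge; apply: lt_le_trans K4.
set a := Num.sqrt L; set b := Num.sqrt (ln L).
have a0 : 0 < a by rewrite sqrtr_gt0.
have a2 : a ^+ 2 = L by rewrite sqr_sqrtr // ltW.
have b2 : b ^+ 2 = ln L by rewrite sqr_sqrtr // ltW.
have b0 : 0 < b by rewrite sqrtr_gt0.
have bK : K ^+ 2 <= b.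
  by rewrite -(@ler_pXn2r _ 2) ?nnegrE ?(ltW b0) ?exprn_ge0 ?b2 -?exprM //; lra.
have bge : 4 <= b by exact: le_trans bK.
have SE : subexp n = a * b by rewrite /subexp -/L sqrtrM // ltW.
split.
- apply: le_trans _ Lge; apply: le_trans _ (expR_ge1Dx _).
  by rewrite lerDl (le_trans _ K4).
- exact: le_trans LLge.
clear Lge LLge K4 K2 nN0 N00 N0 n0n.
have aE : a = expR (b ^+ 2 / 2).
  apply/eqP; rewrite -(@eqrXn2 _ 2) ?expR_ge0 ?ltW // -expRM_natl a2 b2.
  by rewrite mulrC divfK // lnK.
set eta := b / a.
have eta0 : 0 <= eta by rewrite divr_ge0 ?ltW.
have eta2 : eta <= 1 / 2.
  rewrite ler_pdivrMr // aE; have := expR_ge1Dx (b ^+ 2 / 2); nra.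
have h1 : 1 / 2 <= 1 - eta by lra.
have h2 : 1 - eta <= 1 by lra.
have npow : n%:R `^ (1 - eta - 1) = expR (- (a * b)).
  rewrite /powR (gt_eqF nR) -/L -a2; congr expR; rewrite /eta; field; lra.
have l2 := ln2_ge_half; have l1 := ln2_le1.
have hab : - (a * b) + a * b / 2 <= - (a * b / 2) by lra.
have l20 : 0 <= 2 * ln 2 :> R by lra.
(* The cutoff [2 ^ J] lies between [exp (a * b / 4) / 2] and [exp (a * b / 4)]; the factor 2 lost
   here becomes the factor 4 in [hy]. *)
set J := Num.truncn (a * b / (4 * ln 2)).
have q0 : 0 <= a * b / (4 * ln 2).
  by rewrite divr_ge0 ?mulr_ge0 ?ltW //; lra.
have J1 : J%:R * ln 2 <= a * b / 4.
  have : J%:R <= a * b / (4 * ln 2) by rewrite truncn_le.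
  by rewrite ler_pdivlMr; lra.
have J2 : a * b / 4 <= J%:R * ln 2 + ln 2.
  have : a * b / (4 * ln 2) < J.+1%:R by exact: truncnS_gt.
  by rewrite ltr_pdivrMr -?[J.+1]addn1 ?natrD; lra.
have pps : {in primes_upto (2 ^ J), forall p, prime p}.
  by move=> p; rewrite mem_filter => /andP[].
have ups : uniq (primes_upto (2 ^ J)) by rewrite filter_uniq ?iota_uniq.
have yps p : prime p -> (p <= 2 ^ J)%N -> p \in primes_upto (2 ^ J).
  by move=> pp py; rewrite mem_filter pp mem_iota prime_gt0 // add1n ltnS.
have y0 : (0 < 2 ^ J)%N by rewrite expn_gt0.
have hsum : 5 * \sum_(p <- primes_upto (2 ^ J)) (p%:R `^ (- (1 - eta))) <=
    a * b / 2 :> R.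
  (* Here [c = (ln n) ^ (1 / 4)]. It enters twice, through [p ^ eta] and through [sqrt J], and
     [c ^+ 2 = a]. *)
  pose c := expR (b ^+ 2 / 4); have c0 : 0 < c by exact: expR_gt0.
  have c2 : c ^+ 2 = a by rewrite aE -expRM_natl; congr expR; field.
  have hJ : expR (eta * (J%:R * ln 2)) <= c.
    rewrite ler_expR; apply: le_trans (ler_wpM2l eta0 J1) _.
    suff -> : eta * (a * b / 4) = b ^+ 2 / 4 by [].
    by rewrite /eta; field; lra.
  set d := Num.sqrt b; have d2 : d ^+ 2 = b by rewrite sqr_sqrtr // ltW.
  have d0 : 0 < d by rewrite sqrtr_gt0.
  have d80 : K <= d.
    by rewrite -(@ler_pXn2r _ 2) ?nnegrE ?d2 ?(ltW d0) //; lra.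
  have sJ : Num.sqrt J%:R <= c * d.
    rewrite -[leRHS]ger0_norm ?mulr_ge0 ?(ltW c0) ?(ltW d0) // -sqrtr_sqr.
    have hJn : 0 <= J%:R :> R by [].
    by apply: ler_wsqrtr; rewrite exprMn c2 d2; nra.
  apply: (@le_trans _ _ (5 * (c * (8 * (c * d))))).
    rewrite ler_wpM2l //; apply: le_trans (sum_primes_powR J eta0) _.
    by rewrite ler_pM ?expR_ge0 ?mulr_ge0 ?sqrtr_ge0 // ler_wpM2l.
  rewrite (_ : _ * _ = 40 * (c ^+ 2 * d)); last by ring.
  rewrite c2 -d2 expr2 (_ : _ / 2 = a * d * (d / 2)); last by ring.
  rewrite mulrC ler_wpM2l ?mulr_ge0 ?(ltW a0) ?(ltW d0) //; lra.
have hy : ln 2 / (2 ^ J)%:R ^+ 2 <= 4 * ln 2 * expR (- (a * b / 2)).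
  have yE : (2 ^ J)%:R = expR (J%:R * ln 2) :> R.
    by rewrite expRM_natl lnK ?posrE // natrX.
  have hE : expR (a * b / 4) <= 2 * (2 ^ J)%:R.
    rewrite yE; apply: (@le_trans _ _ (expR (J%:R * ln 2 + ln 2))).
      by rewrite ler_expR.
    by rewrite expRD lnK ?posrE // mulrC.
  have E0 : 0 < expR (a * b / 4) by exact: expR_gt0.
  have yR : 0 < (2 ^ J)%:R :> R by rewrite ltr0n.
  rewrite (_ : a * b / 2 = 2%:R * (a * b / 4)); last by field.
  rewrite expRN expRM_natl; move: (expR (a * b / 4)) E0 hE => E E0.
  move: ((2 ^ J)%:R : R) yR {yE} => y yR hE.
  rewrite ler_pdivrMr ?exprn_gt0 // [leRHS]mulrAC ler_pdivlMr ?exprn_gt0 //.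
  have : E ^+ 2 <= (2 * y) ^+ 2.
    by rewrite ler_pXn2r ?nnegrE ?(ltW E0) ?mulr_ge0 ?(ltW yR).
  have l2' : 0 <= ln 2 :> R by lra.
  by move=> /(ler_wpM2l l2'); rewrite exprMn; lra.
have d1 := D_Dpi_dist y0 n0 yps.
have d2 := D_Dpi_dist y0 (leq_trans n0 nn') yps.
have {}d1 := le_trans d1 hy; have {}d2 := le_trans d2 hy; clear hy y0 yps.
have hpi : `|Dpi R (pset (primes_upto (2 ^ J))) n / n%:R -
    Dpi R (pset (primes_upto (2 ^ J))) n' / n'%:R| <=
    2 * ln 2 * expR (- (a * b / 2)).
  apply: le_trans (Dpi_ratio pps ups h1 h2 n0 nn') _; rewrite npow -mulrA ler_wpM2l //.
  by rewrite -expRD ler_expR; apply: le_trans (lerD (lexx _) hsum) hab.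
rewrite SE; set E := expR _ in hpi d1 d2 *.
rewrite distrC in d2; move: d1 d2 hpi; set u := D R n / _; set v := D R n' / _.
set p := Dpi R _ n / _; set q := Dpi R _ n' / _ => d1 d2 hpi.
(* Two tails of at most [4 * ln 2 * E] and a sieve error of at most [2 * ln 2 * E] make up the
   constant 10. *)
rewrite (_ : u - v = (u - p) + (p - q) + (q - v)); last by ring.
apply: le_trans (ler_normD _ _) _; apply: le_trans (lerD (ler_normD _ _) (lexx _)) _.
lra.
Qed.

(** The intervals [[u n - e n, u n + e n]] meet pairwise, as one sees at the larger of the two
    indices. The supremum of their left ends therefore lies in all of them, which gives the limit
    together with its rate. *)
Lemma D_limit : exists (delta : R) (n0 : nat), forall n : nat, (n0 <= n)%N ->
  [/\ 1 <= ln n%:R :> R, 1 <= ln (ln n%:R) :> R &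
  `|D R n / n%:R - delta| <= 10 * ln 2 * expR (- (subexp n / 2))].
Proof.
have [n0 h] := D_ratio_dist.
pose u n := D R n / n%:R; pose e n : R := 10 * ln 2 * expR (- (subexp n / 2)).
have key n m : (n0 <= n)%N -> (n0 <= m)%N -> u n - e n <= u m + e m.
  move=> n0n n0m; have [_ _] := h n (maxn n m) n0n (leq_maxl _ _).
  have [_ _] := h m (maxn n m) n0m (leq_maxr _ _).
  rewrite -/(u n) -/(u m) -/(e n) -/(e m) !ler_norml => /andP[h1 _] /andP[_ h2].
  by move: (u n) (u m) (e n) (e m) (D R _ / _) h1 h2 => x y d d' z; lra.
pose A := [set x : R | exists2 n, (n0 <= n)%N & x = u n - e n]%classic.
have A0 : (A !=set0)%classic by exists (u n0 - e n0), n0.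
exists (sup A), n0 => n n0n; have [l1 l2 _] := h n n n0n (leqnn n); split=> //.
rewrite -/(u n) -/(e n) ler_norml; apply/andP; split.
  rewrite lerBrDl addrC -lerBrDl opprK; apply: ge_sup => // _ [m n0m ->].
  exact: key.
rewrite lerBlDr -lerBlDl; apply: ub_le_sup; last by exists n.
by exists (u n0 + e n0) => _ [m n0m ->]; apply: key.
Qed.

End Limit.

(** * Bounds from the primes 2 and 3 *)

Definition pi23 := pset [:: 2; 3]%N.

(** Two residues modulo 6 are coprime to 6, so whole periods leave no rounding error. *)
Lemma Phi23 q : Phi pi23 (6 * q) = (2 * q)%N.
Proof.
have h N : Phi (pset [::]) N = N.
  rewrite /Phi -[RHS](size_iota 1) -[RHS]count_predT; apply: eq_in_count => m.
  by rewrite mem_iota => /andP[m0 _]; apply/pnatP.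
have h3 N : (Phi (pset [:: 3]) N + N %/ 3 = N)%N.
  by have := @Phi_cons 3 [::] N isT isT; rewrite !h.
have := @Phi_cons 2 [:: 3]%N (6 * q) isT isT; rewrite -/pi23.
have := h3 (6 * q)%N; have := h3 ((6 * q) %/ 2)%N.
have -> : ((6 * q) %/ 2 = 3 * q)%N by rewrite (_ : 6 * q = 3 * q * 2)%N ?mulnK //; lia.
have -> : ((6 * q) %/ 3 = 2 * q)%N by rewrite (_ : 6 * q = 2 * q * 3)%N ?mulnK //; lia.
have -> : ((3 * q) %/ 3 = q)%N by rewrite mulnC mulnK.
lia.
Qed.

(* [(lo, hi, W)] prescribes the vertex set [W] for the rough parts [m] with
   [lo <= n / m < hi]. *)
Definition class := (nat * nat * seq nat)%type.

Fixpoint class_of (tab : seq class) (N : nat) : seq nat :=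
  if tab is c :: tab' then
    if (c.1.1 <= N < c.1.2)%N then c.2 else class_of tab' N
  else [::].

Fixpoint classes_ok (tab : seq class) : Prop :=
  if tab is c :: tab' then
    [/\ (0 < c.1.1 <= c.1.2)%N, {in tab', forall c', c.1.2 <= c'.1.1}%N &
        classes_ok tab']
  else True.

Definition gp_on (rs W : seq nat) : seq (seq nat) :=
  [seq gp_edge t | t <- [seq (a, r) | a <- W, r <- rs]
     & (t.1 * t.2 \in W)%N && (t.1 * t.2 ^ 2 \in W)%N].

Lemma gp_onP rs W e :
  reflect (exists a r, [/\ a \in W, r \in rs, (a * r)%N \in W, (a * r ^ 2)%N \in W
                          & e = gp_edge (a, r)])
          (e \in gp_on rs W).
Proof.
apply: (iffP mapP) => [[[a r]]|[a [r [aW rr arW ar2W ->]]]].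
  rewrite mem_filter => /andP[/andP[/= h1 h2] /allpairsP[[a' r'] /= [am rm [ea er]]]] ->.
  by exists a, r; move: am rm; rewrite -ea -er.
exists (a, r) => //; rewrite mem_filter /= arW ar2W /=; apply/allpairsP.
by exists (a, r).
Qed.

Lemma ne_gp_on rs W : edges_ne (gp_on rs W).
Proof. by apply/negP => /gp_onP[a [r []]]. Qed.

Lemma class_ofP tab N x : x \in class_of tab N ->
  exists c, [/\ c \in tab, (c.1.1 <= N < c.1.2)%N, class_of tab N = c.2 & x \in c.2].
Proof.
elim: tab => //= c tab IH; case: ifP => [h xc|_ /IH[c' [c't h e xc']]].
  by exists c; rewrite mem_head.
by exists c'; rewrite inE c't orbT.
Qed.

Section Classes.
Variable R : realType.
Implicit Types (tab : seq class) (n : nat).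

(** The rough [m] with [lo <= n %/ m < hi] are counted by a difference of two values of [Phi]. The
    classes are disjoint intervals, and an [m] outside all of them gets the empty window, where [F]
    is 0. *)
Lemma sum_classes (F : seq nat -> R) tab n : F [::] = 0 -> classes_ok tab ->
  \sum_(m <- iota 1 n | pi23^'.-nat m) F (class_of tab (n %/ m)) =
  \sum_(c <- tab) F c.2 *
    ((Phi pi23 (n %/ c.1.1))%:R - (Phi pi23 (n %/ c.1.2))%:R).
Proof.
move=> F0; elim: tab => [|c tab IH] /=.
  by rewrite big_nil F0 big1.
move=> [/andP[lo0 lohi] hlo hok]; rewrite big_cons -IH //.
have cnt_ge s : (0 < s)%N -> (Phi pi23 (n %/ s))%:R =
    \sum_(m <- iota 1 n | pi23^'.-nat m) (s <= n %/ m)%N%:R :> R.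
  move=> s0; rewrite -Phi_divn // -sum1_count natr_sum big_mkcondr /=.
  rewrite big_seq_cond [RHS]big_seq_cond; apply: eq_bigr => m /andP[].
  by rewrite mem_iota => /andP[m0 _] _; rewrite leq_divRL //; case: ifP.
rewrite (cnt_ge _ lo0) (cnt_ge _ (leq_trans lo0 lohi)) -sumrB mulr_sumr -big_split /=.
apply: eq_bigr => m _; set N := (n %/ m)%N.
have later : (N < c.1.2)%N -> class_of tab N = [::].
  move=> Nhi; case e: (class_of tab N) => [//|x l].
  have /class_ofP[c' [c't /andP[h _] _ _]] : x \in class_of tab N by rewrite e mem_head.
  by have := leq_trans (leq_trans Nhi (hlo _ c't)) h; rewrite ltnn.
case: (leqP c.1.1 N) => h1; case: (ltnP N c.1.2) => h2 /=.
- by rewrite later // F0 subr0 mulr1 addr0.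
- by rewrite subrr mulr0 add0r.
- by rewrite later // F0 subr0 mulr0 addr0.
- by have := leq_trans (leq_ltn_trans h2 h1) lohi; rewrite ltnn.
Qed.

(** Fewer edges mean a smaller loss: each block keeps only the progressions inside its window with a
    ratio from [rs]. This is the side that bounds [H] from above. *)
Lemma D_ge_classes rs tab n :
    {in rs, forall r, pi23.-nat r && (1 < r)}%N ->
    {in tab, forall c : class, {in c.2, forall s, pi23.-nat s && (s <= c.1.1)}%N} ->
  \sum_(m <- iota 1 n | pi23^'.-nat m) loss R (gp_on rs (class_of tab (n %/ m)))
    <= D R n.
Proof.
move=> hrs htab; apply: le_trans (D_ge_Dpi R pi23 n); rewrite Dpi_sum.
apply: ler_sum => m _; apply: loss_le; rewrite ?ne_gp ?ne_gp_on //.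
apply: refines_sub => e /gp_onP[a [r [aW rr _ ar2W ->]]]; apply/gpP; exists a, r.
have /andP[pr r1] := hrs _ rr.
have [c [ct /andP[loN _] _ ac]] := class_ofP aW.
have /andP[pa _] := htab _ ct _ ac.
have [c' [ct' /andP[loN' _] _ ac']] := class_ofP ar2W.
have /andP[_ le] := htab _ ct' _ ac'.
by split=> //; split=> //; [case/andP: pa | apply: leq_trans le loN'].
Qed.

Lemma loss_cat3 L1 L2 L3 : edges_ne L1 -> edges_ne L2 -> edges_ne L3 ->
  loss R (L1 ++ L2 ++ L3) <= loss R L1 + (loss R L2 + loss R L3).
Proof.
move=> n1 n2 n3; apply: le_trans (loss_cat _ n1 _) _; rewrite ?ne_cat ?n2 //.
by rewrite lerD2l loss_cat.
Qed.

(** The first terms run through [(n / 96, n / r ^ 2]], so these are the progressions of ratio [r]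
    that lie entirely in [(n / 96, n]]. *)
Definition gp_long (r n : nat) : seq (seq nat) :=
  [seq gp_edge (a, r) | a <- iota (n %/ 96).+1 (n %/ r ^ 2 - n %/ 96)].

Lemma ne_gp_long r n : edges_ne (gp_long r n).
Proof. by apply/negP => /mapP[]. Qed.

Lemma loss_gp_long r n : (1 < r)%N ->
  loss R (gp_long r n) <= (n %/ r ^ 2 - n %/ 96)%N%:R * ln (8 / 7).
Proof.
move=> r1; pose s := iota (n %/ 96).+1 (n %/ r ^ 2 - n %/ 96).
have -> : gp_long r n = flatten [seq [:: gp_edge (a, r)] | a <- s].
  by rewrite /gp_long -/s; elim: (s) => //= a l ->.
apply: le_trans (loss_flatten_le _ _ _) _ => [a|]; first by [].
rewrite -[X in X%:R * _](size_iota (n %/ 96).+1) -/s.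
have : {in s, forall a, 0 < a}%N by move=> a; rewrite mem_iota => /andP[/(leq_trans _)->].
elim: (s) => [|a l IH] h; first by rewrite big_nil mul0r.
rewrite big_cons /= -[(size l).+1]add1n natrD mulrDl mul1r; apply: lerD.
  have a0 : (0 < a)%N by apply: h; rewrite mem_head.
  rewrite /gp_edge /= loss3 //= !inE; apply/and3P; split=> //; first apply/norP; nia.
by apply: IH => b bl; apply: h; rewrite inE bl orbT.
Qed.

Lemma loss_gp_on rs W : uniq W ->
  loss R (gp_on rs W) =
  (size W)%:R * ln 2 - ln (cnt W (edge_free (gp_on rs W)))%:R.
Proof.
move=> uW; apply: loss_on => //; first exact: ne_gp_on.
move=> x /flattenP[_ /gp_onP[a [r [aW _ arW ar2W ->]]]].
by rewrite !inE => /or3P[]/eqP->.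
Qed.

(* The integers outside the blocks [m * W] are discarded; what remains lies in
   (n/96, n], so a progression that is not contained in a block has ratio 5 or
   7, and these are accounted for by the Harris inequality. *)
Lemma D_le_classes tab n (rs := [:: 2; 3; 4; 6; 8; 9]%N) :
    {in tab, forall c : class, uniq c.2 /\
      {in c.2, forall s, [&& pi23.-nat s, s <= c.1.1 & c.1.2 <= 96 * s]}%N} ->
  D R n <= n%:R * ln 2 - \sum_(m <- iota 1 n | pi23^'.-nat m)
      ln (cnt (class_of tab (n %/ m))
        (edge_free (gp_on rs (class_of tab (n %/ m)))))%:R
    + ((n %/ 25 - n %/ 96) + (n %/ 49 - n %/ 96))%N%:R * ln (8 / 7).
Proof.
move=> htab.
pose ms := [seq m <- iota 1 n | pi23^'.-nat m].
pose Wf m := class_of tab (n %/ m).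
have mem_ms m : m \in ms -> [/\ (0 < m)%N, (m <= n)%N & pi23^'.-nat m].
  by rewrite mem_filter mem_iota add1n ltnS => /and3P[].
have WfP m s : s \in Wf m -> [/\ pi23.-nat s, (s <= n %/ m)%N & (n %/ m < 96 * s)%N].
  move=> /class_ofP[c [ct /andP[lo hi] _ sc]].
  have [_ /(_ _ sc) /and3P[h1 h2 h3]] := htab _ ct.
  by split=> //; [exact: leq_trans lo|exact: leq_trans h3].
have uWf m : uniq (Wf m).
  case e : (Wf m) => [//|x l]; have : x \in Wf m by rewrite e mem_head.
  by move=> /class_ofP[c [ct _ ec _]]; rewrite -e /Wf ec; case: (htab _ ct).
pose U := [seq (m * s)%N | m <- ms, s <- Wf m].
have UP x : x \in U -> exists m s, [/\ m \in ms, s \in Wf m & x = (m * s)%N].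
  by move=> /allpairsPdep[m [s [h1 h2 ->]]]; exists m, s.
have uU : uniq U.
  apply: allpairs_uniq_dep => [|m _|]; rewrite ?filter_uniq ?iota_uniq ?uWf //.
  move=> [m s] [k t] /allpairsPdep[m' [s' [hm hs e]]] /allpairsPdep[k' [t' [hk ht e']]] /=.
  have [em es] : m = m' /\ s = s' by case: e.
  have [ek et] : k = k' /\ t = t' by case: e'.
  subst m' s' k' t' => eq.
  have [m0 _ pm] := mem_ms _ hm; have [k0 _ pk] := mem_ms _ hk.
  have [ps _ _] := WfP _ _ hs; have [pt _ _] := WfP _ _ ht.
  have mk : m = k by rewrite -(partn_mul_id ps pm) eq partn_mul_id.
  move: eq; rewrite mk => /eqP; rewrite eqn_pmul2l // => /eqP->.
  by [].
have U_iota : {subset U <= iota 1 n}.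
  move=> x /UP[m [s [hm hs ->]]]; have [m0 _ _] := mem_ms _ hm.
  have [/andP[s0 _] sn _] := WfP _ _ hs.
  by rewrite mem_iota add1n ltnS muln_gt0 m0 s0 mulnC -leq_divRL.
pose F m := [seq map (muln m) e | e <- gp_on rs (Wf m)].
have neF m : edges_ne (F m).
  by apply/negP => /mapP[[|//] h _]; have /negP := @ne_gp_on rs (Wf m).
pose B := flatten [seq F m | m <- ms].
have neB : edges_ne B by exact: ne_flatten.
pose K := [seq x <- iota 1 n | x \notin U].
have neK : edges_ne [seq [:: a] | a <- K] by apply/negP => /mapP[].
have sizeK : (size K + size U = n)%N.
  rewrite -[RHS](size_iota 1) -[RHS](count_predC [in U]) addnC; congr addn.
    rewrite -size_filter; apply: perm_size; apply: uniq_perm => //.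
      by rewrite filter_uniq ?iota_uniq.
    move=> x; rewrite mem_filter; apply/idP/andP => [xU|[]//].
    by split=> //; exact: U_iota.
  by rewrite /K size_filter.
have sizeU : (size U)%:R = \sum_(m <- ms) (size (Wf m))%:R :> R.
  rewrite size_allpairs_dep sumnE big_map natr_sum.
  by [].
pose L57 := gp_long 5 n ++ gp_long 7 n.
have ne57 : edges_ne L57 by rewrite ne_cat !ne_gp_long.
have ref : refines (gp predT predT n) (B ++ L57 ++ [seq [:: a] | a <- K]).
  move=> e /gpP[a [r [[a0 r1 arn] _ _ ->]]].
  have le_a j : (j <= 2)%N -> (a * r ^ j)%N \in iota 1 n.
    move=> j2; rewrite mem_iota add1n ltnS muln_gt0 a0 expn_gt0 (ltnW r1) /=.
    by apply: leq_trans arn; rewrite leq_mul2l leq_exp2l ?j2 ?orbT.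
  have kill j : (j <= 2)%N -> (a * r ^ j)%N \notin U ->
      exists2 e', e' \in B ++ L57 ++ [seq [:: a] | a <- K] &
        {subset e' <= gp_edge (a, r)}.
    move=> j2 jU; exists [:: a * r ^ j]%N.
      by rewrite !mem_cat; apply/or3P/Or33/map_f; rewrite mem_filter jU le_a.
    move=> x; rewrite inE => /eqP->; case: j j2 {jU} => [|[|[|//]]] _;
      by rewrite ?expn0 ?expn1 ?muln1 /gp_edge /= !inE eqxx ?orbT.
  case aU : ((a * r ^ 0)%N \in U); last by apply: (kill 0%N); rewrite ?aU.
  case bU : ((a * r ^ 1)%N \in U); last by apply: (kill 1%N); rewrite ?bU.
  case cU : ((a * r ^ 2)%N \in U); last by apply: (kill 2%N); rewrite ?cU.
  have [m [s [hm hs ea]]] := UP _ aU; rewrite expn0 muln1 in ea.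
  have [m0 mn pm] := mem_ms _ hm; have [ps sn sN] := WfP _ _ hs.
  have n96 : (n < 96 * a)%N by rewrite ea mulnCA mulnC -ltn_divLR.
  (* A ratio of 10 or more needs [100 * a <= n], whereas the kept integers satisfy [n < 96 * a]. *)
  have r9 : (r <= 9)%N.
    rewrite leqNgt; apply/negP => r10.
    have : (a * 10 ^ 2 <= n)%N by apply: leq_trans arn; rewrite leq_mul2l leq_exp2r ?r10 ?orbT.
    move=> /leq_ltn_trans/(_ n96).
    by rewrite mulnC ltn_mul2r (_ : (10 ^ 2 < 96)%N = false) ?andbF.
  have long : (r == 5) || (r == 7) -> gp_edge (a, r) \in L57.
    move=> r57; rewrite mem_cat; apply/orP.
    have aI : a \in iota (n %/ 96).+1 (n %/ r ^ 2 - n %/ 96).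
      have lo : (n %/ 96 < a)%N by rewrite ltn_divLR // mulnC.
      have hi : (a <= n %/ r ^ 2)%N by rewrite leq_divRL ?expn_gt0 ?(ltnW r1).
      by rewrite mem_iota lo addSn ltnS subnKC // (leq_trans (ltnW lo)).
    by case/orP: r57 aI => /eqP-> aI; [left|right]; apply: map_f.
  case r57 : ((r == 5) || (r == 7)).
    by exists (gp_edge (a, r)) => //; rewrite !mem_cat -mem_cat long // orbT.
  have rrs : r \in rs.
    move: r r1 r9 r57 {aU bU cU long kill le_a arn}.
    by move=> [|[|[|[|[|[|[|[|[|[|]]]]]]]]]].
  have pr : pi23.-nat r by move/allP: (isT : all (pnat pi23) rs); apply.
  (* A kept integer determines its rough part; the other terms of the progression thus belong to the
     block [m] of the first one. *)
  have blk x : pi23.-nat x -> (m * x)%N \in U -> x \in Wf m.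
    move=> px /UP[k [t [hk ht ex]]]; have [k0 _ pk] := mem_ms _ hk.
    have [pt _ _] := WfP _ _ ht.
    have mk : m = k by rewrite -(partn_mul_id px pm) ex partn_mul_id.
    by move: ex; rewrite mk => /eqP; rewrite eqn_pmul2l // => /eqP->.
  exists (gp_edge (a, r)) => //; rewrite mem_cat; apply/orP; left.
  apply/flattenP; exists (F m); first exact: map_f.
  apply/mapP; exists (gp_edge (s, r)); last by rewrite /gp_edge /= ea !mulnA.
  apply/gp_onP; exists s, r; split=> //; apply: blk.
  - by rewrite pnatM ps pr.
  - by rewrite mulnA -ea -[r in (a * r)%N]expn1.
  - by rewrite pnatM ps pnatX pr.
  - by rewrite mulnA -ea.
have neL : edges_ne (B ++ L57 ++ [seq [:: a] | a <- K]) by rewrite ne_cat neB ne_cat ne57.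
apply: le_trans (loss_le _ (ne_gp _ _ _) neL ref) _.
apply: le_trans (loss_cat3 neB ne57 neK) _.
have hB : loss R B <= (size U)%:R * ln 2 -
    \sum_(m <- ms) ln (cnt (Wf m) (edge_free (gp_on rs (Wf m))))%:R.
  apply: le_trans (loss_flatten_le _ _ _) _ => //.
  rewrite sizeU mulr_suml -sumrB big_seq [leRHS]big_seq; apply: ler_sum => m /mem_ms[m0 _ _].
  rewrite -loss_gp_on // /F loss_map ?ne_gp_on // => x y _ _ /eqP.
  by rewrite eqn_pmul2l // => /eqP.
have h57 : loss R L57 <= ((n %/ 25 - n %/ 96) + (n %/ 49 - n %/ 96))%N%:R * ln (8 / 7).
  apply: le_trans (loss_cat _ (ne_gp_long _ _) (ne_gp_long _ _)) _.
  by rewrite natrD mulrDl; apply: lerD; exact: loss_gp_long.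
have hK := loss_kill R K.
rewrite -/ms -big_filter -/ms.
have nE : n%:R = (size K)%:R + (size U)%:R :> R by rewrite -natrD sizeK.
rewrite nE.
move: hB h57 hK; set x1 := loss R B; set x2 := loss R L57; set x3 := loss R _.
move: (size U)%:R (size K)%:R => u k.
set S := \sum_(_ <- _) _; set y := _ * ln (8 / 7); move: (ln 2) => l.
lra.
Qed.

End Classes.

(** * Counting free sets by dynamic programming *)

Definition memN (x : N) (e : seq N) := has (N.eqb x) e.
(** Deletion treats the sets without [x], for which the edges through [x] are harmless; contraction
    ([conN]) treats the sets with [x], for which these edges shrink. *)
Definition delN (x : N) (L : seq (seq N)) := [seq e <- L | ~~ memN x e].
Definition conN (x : N) (L : seq (seq N)) :=
  [seq [seq y <- e | ~~ (x =? y)%num] | e <- L].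

Fixpoint edge_cmp (s t : seq N) : comparison :=
  match s, t with
  | [::], [::] => Eq
  | [::], _ => Lt
  | _, [::] => Gt
  | x :: s', y :: t' => if (x ?= y)%num is Eq then edge_cmp s' t' else (x ?= y)%num
  end.

Fixpoint key_cmp (s t : seq (seq N)) : comparison :=
  match s, t with
  | [::], [::] => Eq
  | [::], _ => Lt
  | _, [::] => Gt
  | x :: s', y :: t' => if edge_cmp x y is Eq then key_cmp s' t' else edge_cmp x y
  end.

Definition state := (seq (seq N) * N)%type.

Fixpoint combine (k : seq (seq N)) (c : N) (l : seq state) : seq state :=
  if l is (k', c') :: l' then
    if key_cmp k k' is Eq then combine k (c + c')%num l'
    else (k, c) :: combine k' c' l'
  else [:: (k, c)].

Definition merge_states (l : seq state) : seq state :=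
  if sort (fun s t : state => if key_cmp s.1 t.1 is Gt then false else true) l
    is (k, c) :: l' then combine k c l' else [::].

(** [F] holds the untouched edges through [x]; those avoiding [x] are common to all states and stay
    out of the keys, which keeps the keys short. A contraction that empties an edge admits no free
    set and is dropped. *)
Definition dp_step (x : N) (F : seq (seq N)) (s : state) : seq state :=
  let k := conN x (s.1 ++ F) in
  (delN x s.1, s.2) :: (if has (@nilp _) k then [::] else [:: (k, s.2)]).

(* A state [(k, c)] records that [c] choices on the vertices already treated
   leave the residual hypergraph [k ++ F]. *)
Fixpoint dp (s : seq N) (F : seq (seq N)) (st : seq state) : N :=
  if s is x :: s' then
    dp s' (delN x F)
      (merge_states (flatten [seq dp_step x [seq e <- F | memN x e] t | t <- st]))
  else foldr (fun t n => (t.2 + n)%num) 0%num st.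

(* The number [a + 32 * b] encodes [2 ^ a * 3 ^ b], so that multiplication
   becomes addition as long as [a < 32]. *)
Definition node_val (t : N) : N := N.shiftl (3 ^ (t / 32)) (t mod 32).

Definition node_edges (W rs : seq N) : seq (seq N) :=
  [seq [:: t.1; t.1 + t.2; t.1 + t.2 + t.2]%num
     | t <- [seq (a, r) | a <- W, r <- rs]
     & memN (t.1 + t.2)%num W && memN (t.1 + t.2 + t.2)%num W].

Definition count_free (W rs : seq N) : N := dp W (node_edges W rs) [:: ([::], 1%num)].

(* Eliminating the vertices by decreasing powers of 3 keeps the number of states
   small. *)
Definition nodes (A B : nat) (T : N) : seq N :=
  [seq t <- [seq (N.of_nat a + 32 * N.of_nat b)%num | b <- rev (iota 0 B), a <- iota 0 A]
     | (node_val t <=? T)%num].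

Definition sorted_nodes A B T : seq N :=
  sort (fun s t => (node_val s <=? node_val t)%num) (nodes A B T).

(* [log_lo g] and [log_hi g] bracket [2 ^ log_prec * log_2 g]: the mantissa is
   squared [log_prec] times, and cut to 32 bits after each squaring. *)
Fixpoint log_iter (up : bool) (k : nat) (m e : N) : N * N :=
  if k is k'.+1 then
    let m2 := (m * m)%num in let t := (N.size m2 - 32)%num in
    log_iter up k' (N.shiftr m2 t + (if up then 1 else 0))%num (2 * e + t)%num
  else (m, e).

Definition log_prec : nat := 13.

Definition log_lo (g : N) : N :=
  let r := log_iter false log_prec g 0 in (r.2 + N.log2 r.1)%num.
Definition log_hi (g : N) : N :=
  let r := log_iter true log_prec g 0 in (r.2 + N.log2 r.1 + 1)%num.

(* A common multiple of the node values. *)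
Definition n_unit : N := N.shiftl (3 ^ 14) 24.

(* For [n] a multiple of [6 * n_unit], the number of rough parts [m] with
   [t <= n / m] is proportional to [n_unit / t], which gives the weights. *)
Fixpoint walk (f : N -> N -> N) (l : seq N) : N :=
  if l is t :: l' then
    if l' is t' :: _ then
      ((n_unit / node_val t - n_unit / node_val t') * f t t' + walk f l')%num
    else 0%num
  else 0%num.

Definition chain_ok (l : seq N) : bool :=
  all (fun t => n_unit mod node_val t =? 0)%num l &&
  sorted (fun s t => node_val s <=? node_val t)%num l.

Lemma tnD m n : N.to_nat (m + n)%num = (N.to_nat m + N.to_nat n)%N.
Proof. exact: Nnat.N2Nat.inj_add. Qed.

Lemma tnM m n : N.to_nat (m * n)%num = (N.to_nat m * N.to_nat n)%N.
Proof. exact: Nnat.N2Nat.inj_mul. Qed.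

Lemma tn_inj : injective N.to_nat.
Proof. exact: Nnat.N2Nat.inj. Qed.

Lemma memNE x e : memN x e = (x \in e).
Proof.
apply/hasP/idP => [[y ye /N.eqb_eq->//]|xe]; exists x => //; exact/N.eqb_eq.
Qed.

Lemma edge_cmp_eq s t : edge_cmp s t = Eq -> s = t.
Proof.
elim: s t => [|x s IH] [|y t] //=; case e: (x ?= y)%num => //.
by move/N.compare_eq: e => -> /IH->.
Qed.

Lemma key_cmp_eq s t : key_cmp s t = Eq -> s = t.
Proof.
elim: s t => [|x s IH] [|y t] //=; case e: (edge_cmp x y) => //.
by move/edge_cmp_eq: e => -> /IH->.
Qed.

Lemma combine_sum (f : seq (seq N) -> nat) k c l :
  (\sum_(t <- combine k c l) N.to_nat t.2 * f t.1 =
   N.to_nat c * f k + \sum_(t <- l) N.to_nat t.2 * f t.1)%N.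
Proof.
elim: l k c => [|[k' c'] l IH] k c /=; first by rewrite big_seq1 big_nil addn0.
case e: (key_cmp k k'); rewrite ?big_cons IH ?big_cons //=.
by rewrite (key_cmp_eq e) tnD mulnDl addnA.
Qed.

(** Soundness of merging rests on two facts: sorting permutes the states, and the answer [Eq] means
    equal keys. *)
Lemma merge_sum (f : seq (seq N) -> nat) l :
  (\sum_(t <- merge_states l) N.to_nat t.2 * f t.1 =
   \sum_(t <- l) N.to_nat t.2 * f t.1)%N.
Proof.
rewrite /merge_states; set r := fun s t : state => _.
rewrite -[RHS](perm_big _ (permEl (perm_sort r l))) /=.
by case: (sort r l) => [|[k c] l'] //; rewrite combine_sum big_cons.
Qed.

Lemma merge_all (P : pred (seq (seq N))) l :
  all (fun t => P t.1) l -> all (fun t => P t.1) (merge_states l).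
Proof.
rewrite /merge_states; set r := fun s t : state => _.
rewrite -(perm_all _ (permEl (perm_sort r l))).
case: (sort r l) => [|[k c] l'] //= /andP[].
elim: l' k c => [|[k' c'] l' IH] k c /= Pk; first by rewrite Pk.
by case e: (key_cmp k k') => /andP[Pk' h] /=; rewrite ?Pk ?IH.
Qed.

Definition natify (L : seq (seq N)) : seq (seq nat) := [seq map N.to_nat e | e <- L].

Lemma eq_edge_free L L' X : L =i L' -> edge_free L X = edge_free L' X.
Proof. by move=> h; rewrite /edge_free (eq_all_r h). Qed.

Lemma cnt_del_con x s L : x \notin s ->
  cnt (x :: s) (edge_free L) =
  (cnt s (edge_free [seq e <- L | x \notin e]) +
   cnt s (edge_free [seq [seq y <- e | y != x] | e <- L]))%N.
Proof.
move=> xs /=; congr addn; apply: eq_cnt => X Xs.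
  rewrite /edge_free all_filter; apply: eq_all => e /=.
  case xe: (x \in e) => //=; apply/negP => /allP/(_ _ xe)/Xs.
  by rewrite (negPf xs).
rewrite /edge_free all_map; apply: eq_all => e /=; rewrite all_filter.
by congr (~~ _); apply: eq_all => y /=; case: eqP => //= ->.
Qed.

Lemma cntN_del_con x s L : x \notin s ->
  cnt (map N.to_nat (x :: s)) (edge_free (natify L)) =
  (cnt (map N.to_nat s) (edge_free (natify (delN x L))) +
   cnt (map N.to_nat s) (edge_free (natify (conN x L))))%N.
Proof.
move=> xs; rewrite map_cons cnt_del_con ?(mem_map tn_inj) //; congr addn.
  congr (cnt _ (edge_free _)); rewrite /natify /delN filter_map; congr map.
  by apply: eq_filter => e /=; rewrite memNE (mem_map tn_inj).
congr (cnt _ (edge_free _)); rewrite /natify /conN -!map_comp.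
apply: eq_map => e /=; rewrite filter_map; congr map; apply: eq_filter => y /=.
by rewrite (inj_eq tn_inj) eq_sym.
Qed.

Lemma cnt_nil s L : [::] \in L -> cnt s (edge_free L) = 0%N.
Proof.
move=> nL; rewrite (@eq_cnt _ _ pred0).
  by elim: s => //= x s ->; elim: s => //= y s IHs; rewrite -[RHS]IHs.
by move=> X _; apply/negP => /allP/(_ _ nL).
Qed.

(** The invariant of the elimination: treating a vertex preserves the number of completions of the
    states, weighted by their multiplicities. *)
Lemma dp_spec s F st : uniq s -> all (fun t => [::] \notin t.1) st ->
    [::] \notin F ->
  N.to_nat (dp s F st) =
  (\sum_(t <- st) N.to_nat t.2 *
     cnt (map N.to_nat s) (edge_free (natify (t.1 ++ F))))%N.
Proof.
elim: s F st => [|x s IH] F st /= us hst hF.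
  elim: st hst => [|[k c] st IHst] /=; first by rewrite big_nil.
  move=> /andP[hk /IHst h]; rewrite big_cons tnD h /=; congr addn.
  rewrite (_ : edge_free _ _ = true) ?muln1 //; apply/allP => e /mapP[e' e'k ->].
  case: e' e'k => [|y e'] //=; rewrite mem_cat => /orP[] h'.
    by rewrite h' in hk.
  by rewrite h' in hF.
move: us => /andP[xs us].
rewrite IH //; last first.
- by apply: contra hF; rewrite mem_filter => /andP[].
- apply: (merge_all (P := fun k => [::] \notin k)); apply/allP => t.
  move=> /flattenP[_ /mapP[[k c] kst ->]].
  have hk := allP hst _ kst; rewrite /dp_step /= inE => /predU1P[->|] /=.
    by apply: contra hk; rewrite mem_filter => /andP[].
  case: ifP => //= /negbT h; rewrite inE => /eqP-> /=; apply: contra h => h.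
  by apply/hasP; exists [::].
pose f k := cnt (map N.to_nat s) (edge_free (natify (k ++ delN x F))).
rewrite (merge_sum f) big_flatten big_map; apply: eq_bigr => -[k c] _ /=.
set F1 := [seq e <- F | memN x e].
rewrite (cntN_del_con (k ++ F) xs : (_ + _ = _)%N) mulnDr.
rewrite /dp_step big_cons /=; congr addn.
  by congr (_ * _)%N; rewrite /f /delN filter_cat.
(* Contraction alters only those edges of [F] that pass through [x]; the others are found in
   [delN x F]. *)
have -> : cnt (map N.to_nat s) (edge_free (natify (conN x (k ++ F)))) = f (conN x (k ++ F1)).
  apply: eq_cnt => X _; apply: eq_edge_free => e; apply/mapP/mapP.
    move=> [e1 /mapP[e2 e2k ->] ->]; exists [seq y <- e2 | ~~ (x =? y)%num] => //.
    move: e2k; rewrite !mem_cat => /orP[e2k|e2F].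
      by apply/orP; left; apply: map_f; rewrite mem_cat e2k.
    case xe : (memN x e2); apply/orP; [left|right].
      by apply: map_f; rewrite mem_cat mem_filter xe e2F orbT.
    rewrite (_ : [seq _ <- _ | _] = e2) ?mem_filter ?xe //.
    apply/all_filterP/allP => y ye; apply/negP => /N.eqb_eq xy.
    by move: xe; rewrite memNE xy ye.
  move=> [e1 + ->]; rewrite mem_cat => /orP[/mapP[e2 e2k ->]|].
    exists [seq y <- e2 | ~~ (x =? y)%num] => //; apply: map_f.
    by move: e2k; rewrite !mem_cat mem_filter => /orP[->//|/andP[_ ->]]; rewrite orbT.
  rewrite mem_filter => /andP[xe e1F]; exists e1 => //.
  rewrite -[e1](_ : [seq y <- e1 | ~~ (x =? y)%num] = e1).
    by apply: map_f; rewrite mem_cat e1F orbT.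
  apply/all_filterP/allP => y ye; apply/negP => /N.eqb_eq xy.
  by move: xe; rewrite memNE xy ye.
case: ifP => h; last by rewrite big_seq1.
rewrite big_nil /f cnt_nil ?muln0 //; apply/mapP; exists [::] => //.
by rewrite mem_cat; apply/orP; left; case/hasP: h => -[|//].
Qed.

Definition nval (t : N) : nat := N.to_nat (node_val t).

Lemma tn_pow m n : N.to_nat (m ^ n)%num = (N.to_nat m ^ N.to_nat n)%N.
Proof.
rewrite Nnat.N2Nat.inj_pow; elim: (N.to_nat n) => //= k IH.
by rewrite expnS -IH.
Qed.

Lemma nvalE t :
  nval t = (2 ^ N.to_nat (t mod 32)%num * 3 ^ N.to_nat (t / 32)%num)%N.
Proof. by rewrite /nval /node_val N.shiftl_mul_pow2 tnM !tn_pow mulnC. Qed.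

Lemma nval_gt0 t : (0 < nval t)%N.
Proof. by rewrite nvalE muln_gt0 !expn_gt0. Qed.

Lemma nval_inj : injective nval.
Proof.
move=> s t; rewrite !nvalE => e.
have h p a b : prime p -> logn p (2 ^ a * 3 ^ b) = (a * (p == 2) + b * (p == 3))%N.
  by move=> pp; rewrite lognM ?expn_gt0 // !lognX !logn_prime.
have h2 := congr1 (logn 2) e; have h3 := congr1 (logn 3) e.
rewrite !h //= !muln0 !muln1 ?addn0 ?add0n in h2 h3.
rewrite (N.div_mod' s 32) (N.div_mod' t 32).
by rewrite (tn_inj h2) (tn_inj h3).
Qed.

(** Without a carry out of the low five bits, the exponents of 2 and of 3 add separately. *)
Lemma nval_add s r : (s mod 32 + r mod 32 <? 32)%num ->
  nval (s + r)%num = (nval s * nval r)%N.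
Proof.
move=> /N.ltb_lt h; rewrite !nvalE.
have e : (s + r = 32 * (s / 32 + r / 32) + (s mod 32 + r mod 32))%num.
  have := N.div_mod' s 32; have := N.div_mod' r 32; lia.
rewrite -(N.mod_unique _ _ _ _ h e) -(N.div_unique _ _ _ _ h e) !tnD !expnD.
by rewrite mulnACA.
Qed.

Lemma pi23_nval t : pi23.-nat (nval t).
Proof. by rewrite nvalE pnatM !pnatX. Qed.

Lemma N_leb_nat m n : (m <=? n)%num = (N.to_nat m <= N.to_nat n)%N.
Proof. by apply/idP/idP => [/N.leb_le h|h]; [|apply/N.leb_le]; lia. Qed.

Lemma node_edges_inE W rs e : reflect
  (exists t r, [/\ t \in W, r \in rs, (t + r)%num \in W, (t + r + r)%num \in W &
     e = [:: t; t + r; t + r + r]%num]) (e \in node_edges W rs).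
Proof.
apply: (iffP mapP) => [[[t r]]|[t [r [tW rr h1 h2 ->]]]].
  rewrite mem_filter !memNE => /andP[/andP[/= h1 h2] /allpairsP[[t' r'] /= [tm rm [et er]]]] ->.
  by exists t, r; move: tm rm; rewrite -et -er.
exists (t, r) => //; rewrite mem_filter /= !memNE h1 h2; apply/allpairsP.
by exists (t, r).
Qed.

(* No carry can occur when forming [t + 2 r]. *)
Definition small_nodes (W rs : seq N) : bool :=
  all (fun t => t mod 32 <=? 23)%num W && all (fun r => r mod 32 <=? 4)%num rs.

Section Tables.
Variable R : realType.

(** The dynamic programming runs on codes; since [nval] is injective, [loss_map] carries the loss
    over to the integers [2 ^ a * 3 ^ b]. *)
Lemma loss_node_edges W rs : uniq W -> small_nodes W rs ->
  loss R (gp_on (map nval rs) (map nval W)) = loss R (natify (node_edges W rs)).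
Proof.
move=> uW /andP[/allP hW /allP hrs].
have ne : edges_ne (natify (node_edges W rs)).
  by apply/negP => /mapP[[|//] /node_edges_inE[t [r []]]].
pose f i := nval (N.of_nat i).
have f_inj : injective f by move=> i j /nval_inj /Nnat.Nat2N.inj.
rewrite -(@loss_map R f _ (in2W f_inj) ne).
have fE t : f (N.to_nat t) = nval t by rewrite /f Nnat.N2Nat.id.
have add t r : t \in W -> r \in rs -> nval (t + r)%num = (nval t * nval r)%N /\
    nval (t + r + r)%num = (nval t * nval r ^ 2)%N.
  move=> /hW /N.leb_le ht /hrs /N.leb_le hr.
  (* The bounds of [small_nodes] give [23 + 4 + 4 = 31] for both multiplications together. *)
  have h1 : (t mod 32 + r mod 32 <? 32)%num by apply/N.ltb_lt; lia.
  have e1 := nval_add h1; split=> //.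
  rewrite nval_add ?e1 ?mulnA //; apply/N.ltb_lt.
  have e : (t + r = 32 * (t / 32 + r / 32) + (t mod 32 + r mod 32))%num.
    have := N.div_mod' t 32; have := N.div_mod' r 32; lia.
  by move/N.ltb_lt: h1 => h1; rewrite -(N.mod_unique _ _ _ _ h1 e); lia.
apply: eq_loss; first exact: ne_gp_on.
move=> e; apply/gp_onP/mapP.
  move=> [a [r [/mapP[t tW ->] /mapP[u urs ->] h1 h2 ->]]].
  have [e1 e2] := add _ _ tW urs.
  rewrite -e1 (mem_map nval_inj) in h1; rewrite -e2 (mem_map nval_inj) in h2.
  exists (map N.to_nat [:: t; t + u; t + u + u]%num).
    by apply/map_f/node_edges_inE; exists t, u.
  by rewrite /gp_edge [RHS]/= !fE e1 e2.
move=> [_ /mapP[_ /node_edges_inE[t [u [tW urs h1 h2 ->]]] ->] ->].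
have [e1 e2] := add _ _ tW urs.
exists (nval t), (nval u); rewrite -e1 -e2 !(mem_map nval_inj); split=> //.
by rewrite /gp_edge [LHS]/= !fE e1 e2.
Qed.

Lemma loss_count_free W rs : uniq W -> small_nodes W rs ->
  loss R (gp_on (map nval rs) (map nval W)) =
  (size W)%:R * ln 2 - ln (N.to_nat (count_free W rs))%:R.
Proof.
move=> uW sm; rewrite loss_node_edges //.
have ne : edges_ne (natify (node_edges W rs)).
  by apply/negP => /mapP[[|//] /node_edges_inE[t [r []]]].
rewrite (@loss_on _ (map N.to_nat W)) ?(map_inj_uniq tn_inj) //; last first.
  move=> x /flattenP[_ /mapP[_ /node_edges_inE[t [r [tW _ h1 h2 ->]]] ->] /mapP[y hy ->]].
  by apply: map_f; move: hy; rewrite !inE => /or3P[]/eqP->.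
rewrite size_map /count_free dp_spec //; last first.
  by apply/negP => /node_edges_inE[t [r []]].
by rewrite big_seq1 mul1n.
Qed.

Lemma ln_cnt_count_free W rs : uniq W -> small_nodes W rs ->
  ln (cnt (map nval W) (edge_free (gp_on (map nval rs) (map nval W))))%:R =
  ln (N.to_nat (count_free W rs))%:R :> R.
Proof.
move=> uW sm; have := loss_count_free uW sm.
rewrite loss_gp_on ?(map_inj_uniq nval_inj) // size_map.
by move/addrI/oppr_inj.
Qed.

End Tables.

(** * Soundness of the fixed-point logarithms *)

Section Logs.
Variable R : realType.
Local Notation lnN m := (ln (N.to_nat m)%:R : R).
Local Notation natN m := ((N.to_nat m)%:R : R).

Lemma shiftr_le m t :
  (N.to_nat (N.shiftr m t) * 2 ^ N.to_nat t <= N.to_nat m)%N /\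
  (N.to_nat m <= N.to_nat (N.shiftr m t + 1) * 2 ^ N.to_nat t)%N.
Proof.
have e2 : (2 ^ t)%num <> 0%num by apply: N.pow_nonzero.
have := N.mul_div_le m _ e2; have := N.mul_succ_div_gt m _ e2.
rewrite -N.shiftr_div_pow2 -(tn_pow 2) -!tnM => h1 h2.
split; first lia.
by rewrite N.add_1_r N.mul_comm; lia.
Qed.

Lemma shiftr_size_gt0 (m : N) : (0 < N.to_nat m)%N ->
  (0 < N.to_nat (N.shiftr m (N.size m - 32)))%N.
Proof.
move=> m0; have mn0 : m <> 0%num by lia.
suff : N.shiftr m (N.size m - 32) <> 0%num by lia.
rewrite N.shiftr_div_pow2; apply/N.neq_0_lt_0/N.div_str_pos; split.
  by apply/N.neq_0_lt_0/N.pow_nonzero.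
apply: N.le_trans (_ : (2 ^ N.log2 m <= m)%num).
  by apply: N.pow_le_mono_r => //; rewrite N.size_log2 //; lia.
by apply: (N.log2_spec m _).1; lia.
Qed.

(** Squaring doubles [ln m + e * ln 2] exactly; cutting [t] bits adds [t] to the exponent and, the
    mantissa being rounded down, can only decrease this quantity. Rounding up gives the opposite
    bound. *)
Lemma log_iter_lo k m e : (0 < N.to_nat m)%N ->
  let r := log_iter false k m e in
  (0 < N.to_nat r.1)%N /\
  lnN r.1 + natN r.2 * ln 2 <= 2 ^+ k * (lnN m + natN e * ln 2).
Proof.
elim: k m e => [|k IH] m e m0 /=; first by rewrite expr0 mul1r.
set m2 := (m * m)%num; set t := (N.size m2 - 32)%num.
have m20 : (0 < N.to_nat m2)%N by rewrite tnM muln_gt0 m0.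
have s0 := shiftr_size_gt0 m20; rewrite -/t in s0.
rewrite N.add_0_r; have [r0 h] := IH _ (2 * e + t)%num s0; split=> //.
apply: le_trans h _; rewrite exprS [2 * _]mulrC -mulrA ler_wpM2l ?exprn_ge0 //.
have [h _] := shiftr_le m2 t.
have : lnN (N.shiftr m2 t) + natN t * ln 2 <= 2 * lnN m.
  rewrite mulr_natl -lnXn // -lnM ?posrE ?exprn_gt0 ?ltr0n //.
  rewrite [leRHS]mulr_natl -lnXn ?ltr0n // ler_ln ?posrE ?mulr_gt0 ?exprn_gt0 ?ltr0n //.
  by rewrite -!natrX -natrM ler_nat (leq_trans h) // tnM mulnn.
rewrite (tnD (2 * e)%num) tnM natrD natrM (_ : N.to_nat 2 = 2%N) //.
move: (lnN _) (lnN m) (natN e) (natN t) => x y z w.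
lra.
Qed.

Lemma log_iter_hi k m e : (0 < N.to_nat m)%N ->
  let r := log_iter true k m e in
  (0 < N.to_nat r.1)%N /\
  2 ^+ k * (lnN m + natN e * ln 2) <= lnN r.1 + natN r.2 * ln 2.
Proof.
elim: k m e => [|k IH] m e m0 /=; first by rewrite expr0 mul1r.
set m2 := (m * m)%num; set t := (N.size m2 - 32)%num.
have s0 : (0 < N.to_nat (N.shiftr m2 t + 1)%num)%N by lia.
have [r0 h] := IH _ (2 * e + t)%num s0; split=> //.
apply: le_trans _ h; rewrite exprS [2 * _]mulrC -mulrA ler_wpM2l ?exprn_ge0 //.
have [_ h'] := shiftr_le m2 t.
have : 2 * lnN m <= lnN (N.shiftr m2 t + 1)%num + natN t * ln 2.
  rewrite [leLHS]mulr_natl -lnXn ?ltr0n // [_ * ln 2]mulr_natl -lnXn //.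
  rewrite -lnM ?posrE ?exprn_gt0 ?ltr0n //.
  rewrite ler_ln ?posrE ?mulr_gt0 ?exprn_gt0 ?ltr0n //.
  by rewrite -!natrX -natrM ler_nat (leq_trans _ h') // tnM mulnn.
rewrite (tnD (2 * e)%num) tnM natrD natrM (_ : N.to_nat 2 = 2%N) //.
move: (lnN (_ + _)%num) (lnN m) (natN e) (natN t) => x y z w.
lra.
Qed.

Lemma log_lo_le g : (0 < N.to_nat g)%N ->
  natN (log_lo g) * ln 2 <= 2 ^+ log_prec * lnN g.
Proof.
move=> g0; have [] := log_iter_lo log_prec 0%num g0.
rewrite /log_lo; case: (log_iter _ _ _ _) => m e /= m0 h.
rewrite mul0r addr0 in h; apply: le_trans h.
rewrite tnD natrD mulrDl addrC lerD2r mulr_natl -lnXn // ler_ln ?posrE ?exprn_gt0 ?ltr0n //.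
rewrite -natrX ler_nat -(tn_pow 2); have := (N.log2_spec m _).1; lia.
Qed.

Lemma log_hi_ge g : (0 < N.to_nat g)%N ->
  2 ^+ log_prec * lnN g <= natN (log_hi g) * ln 2.
Proof.
move=> g0; have [] := log_iter_hi log_prec 0%num g0.
rewrite /log_hi; case: (log_iter _ _ _ _) => m e /= m0 h.
rewrite mul0r addr0 in h; apply: le_trans h _.
rewrite -N.add_assoc tnD natrD mulrDl addrC lerD2l mulr_natl -lnXn //.
rewrite ler_ln ?posrE ?exprn_gt0 ?ltr0n //.
rewrite -natrX ler_nat -(tn_pow 2) N.add_1_r; have := (N.log2_spec m _).2; lia.
Qed.

End Logs.

(** * From the finite computation to sums over rough parts *)

Fixpoint node_classes (Wf : N -> N -> seq N) (l : seq N) : seq class :=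
  if l is t :: l' then
    if l' is t' :: _ then
      (nval t, nval t', map nval (Wf t t')) :: node_classes Wf l'
    else [::]
  else [::].

Lemma node_classes_cons Wf t t' l : node_classes Wf [:: t, t' & l] =
  (nval t, nval t', map nval (Wf t t')) :: node_classes Wf (t' :: l).
Proof. by []. Qed.

Lemma node_classesP Wf l c : c \in node_classes Wf l ->
  exists t t', c = (nval t, nval t', map nval (Wf t t')).
Proof.
case: l => [|t l]; first by rewrite in_nil.
elim: l t => [|t' l IH] t; first by rewrite in_nil.
rewrite ?node_classes_cons inE => /predU1P[->|/IH//].
by exists t, t'.
Qed.

Lemma node_classes_ok Wf l :
  sorted (fun s t => node_val s <=? node_val t)%num l ->
  classes_ok (node_classes Wf l).
Proof.
have tr : transitive (fun s t => node_val s <=? node_val t)%num.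
  by move=> s t u; rewrite !N_leb_nat; apply: leq_trans.
have later X l1 : {in l1, forall u, X <= nval u}%N ->
    {in node_classes Wf l1, forall c : class, X <= c.1.1}%N.
  elim: l1 => [|u [|u' l1] IH] h c; rewrite ?in_nil // node_classes_cons inE.
  move=> /predU1P[->|]; first exact: (h u (mem_head _ _)).
  by apply: IH => v vl; apply: h; rewrite inE vl orbT.
elim: l => [|t [|t' l] IH] //; rewrite node_classes_cons => /= /andP[tt' hp].
split; [by rewrite nval_gt0 -N_leb_nat| |exact: IH].
refine (later (nval t') (t' :: l) _) => u; rewrite inE => /predU1P[->//|ul].
by rewrite -N_leb_nat; apply: (allP (order_path_min tr hp)).
Qed.

(** A unary number of about [8 * 10 ^ 13]: the lock keeps it from being evaluated. *)
Definition unit_nat : nat := locked (N.to_nat n_unit).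

Lemma unit_nat_div t : (n_unit mod node_val t =? 0)%num ->
  unit_nat = (N.to_nat (n_unit / node_val t)%num * nval t)%N.
Proof.
move=> /N.eqb_eq h; rewrite /unit_nat -lock {1}(N.div_mod' n_unit (node_val t)) h.
by rewrite N.add_0_r tnM mulnC.
Qed.

Lemma unit_nat_gt0 : (0 < unit_nat)%N.
Proof.
rewrite /unit_nat -lock lt0n; apply/eqP => h.
have : n_unit = 0%num by apply: tn_inj.
by apply/N.eqb_neq; vm_compute.
Qed.

Lemma unit_nat96 : exists k, unit_nat = (96 * k)%N.
Proof.
exists (N.to_nat (n_unit / 96)); rewrite /unit_nat -lock.
rewrite -[96%N]/(N.to_nat 96) -tnM; congr N.to_nat.
Qed.

(** The factor 6 makes the sieve by 2 and 3 exact, and 25 and 49 do the same for the counts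
    belonging to the ratios 5 and 7; 96 already divides [unit_nat]. *)
Definition n_of (d : nat) : nat := (6 * 25 * 49 * unit_nat * d)%N.

Section Walk.
Variable R : realType.
Local Notation natN m := ((N.to_nat m)%:R : R).

Lemma Phi_unit t d : (n_unit mod node_val t =? 0)%num ->
  (Phi pi23 (n_of d %/ nval t))%:R =
  2 * 25 * 49 * d%:R * natN (n_unit / node_val t)%num.
Proof.
move=> h; rewrite /n_of; set q := N.to_nat _; have -> : unit_nat = (q * nval t)%N := unit_nat_div h.
rewrite (_ : 6 * 25 * 49 * (q * nval t) * d = 6 * (25 * 49 * d * q) * nval t)%N; last first.
  by rewrite -!mulnA; congr (_ * (_ * (_ * _)))%N; rewrite [RHS]mulnCA [(nval t * d)%N]mulnC.
rewrite mulnK ?nval_gt0 // Phi23 !natrM; ring.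
Qed.

Lemma natN_sub m n : (n <=? m)%num -> natN (m - n)%num = natN m - natN n.
Proof.
by rewrite N_leb_nat => le; rewrite Nnat.N2Nat.inj_sub natrB.
Qed.

(** Serves both numerical bounds: [F] is the exact value of a class, [f] its computed lower bound,
    and the weights are nonnegative because the chain is sorted. *)
Lemma walk_le (F : seq nat -> R) Wf f l d :
    (forall t t', natN (f t t') <= F (map nval (Wf t t'))) -> F [::] = 0 ->
    chain_ok l ->
  2 * 25 * 49 * d%:R * natN (walk f l) <=
  \sum_(m <- iota 1 (n_of d) | pi23^'.-nat m)
    F (class_of (node_classes Wf l) (n_of d %/ m)).
Proof.
move=> hF F0 /andP[hdiv hs]; rewrite sum_classes //; last exact: node_classes_ok.
elim: l hdiv hs => [|t [|t' l] IH] hdiv hs; rewrite ?big_nil ?mulr0 //.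
rewrite node_classes_cons big_cons [walk _ _]/=.
rewrite tnD natrD mulrDr; apply: lerD; last first.
  by apply: IH; [case/andP: hdiv|case/andP: hs].
have ht : (n_unit mod node_val t =? 0)%num by case/andP: hdiv.
have ht' : (n_unit mod node_val t' =? 0)%num by case/and3P: hdiv.
have tt' : (node_val t <=? node_val t')%num by case/andP: hs.
rewrite !Phi_unit // -mulrBr mulrCA tnM natrM.
have le : (n_unit / node_val t' <=? n_unit / node_val t)%num.
  apply/N.leb_le/N.div_le_compat_l; split; last exact/N.leb_le.
  by have := nval_gt0 t; rewrite /nval; lia.
rewrite natN_sub // ler_wpM2l ?mulr_ge0 //.
rewrite mulrC; apply: ler_wpM2r; last exact: hF.
by rewrite subr_ge0 ler_nat -N_leb_nat.
Qed.

End Walk.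

(** Codes of 2, 3, 4, 6, 8, 9, the 3-smooth ratios below 10; within the window no larger one
    occurs. *)
Definition rs_lo : seq N := [:: 1; 32; 2; 33; 3; 64]%num.
Definition W_lo (all : seq N) (t t' : N) :=
  [seq s <- all | (node_val s <=? node_val t)%num && (node_val t' <=? 96 * node_val s)%num].

Definition f_lo all t t' := log_lo (count_free (W_lo all t t') rs_lo).

(** Codes of 2, 3, 4, 6, 8, 9, 12, 16, 18, the 3-smooth ratios with [r ^ 2 <= 350], where 350 is the
    bound on the nodes. *)
Definition rs_hi : seq N := [:: 1; 32; 2; 33; 3; 64; 34; 4; 65]%num.
Definition W_hi (all : seq N) (t t' : N) :=
  [seq s <- all | (node_val s <=? node_val t)%num].

Definition f_hi all t t' := let W := W_hi all t t' in
  (N.of_nat (size W) * 2 ^ N.of_nat log_prec - log_hi (count_free W rs_hi))%num.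

(** The exponent ranges cover every [2 ^ a * 3 ^ b] up to 70000, since [2 ^ 17] and [3 ^ 11] are
    larger; likewise 9 and 7 for 350. *)
Definition nodes_lo := nodes 17 11 70000.
Definition lo_nodes := sorted_nodes 17 11 70000.
Definition nodes_hi := nodes 9 7 350.
(* The last node stands for infinity: the blocks with larger [n / m] are ignored. *)
Definition hi_nodes := rcons (sorted_nodes 9 7 350) (23 + 32 * 13)%num.

Definition million := (1000 * 1000)%num.
Definition precN := (2 ^ N.of_nat log_prec)%num.

Lemma chain_lo : chain_ok lo_nodes. Proof. by vm_compute. Qed.

Lemma chain_hi : chain_ok hi_nodes. Proof. by vm_compute. Qed.

Lemma uniq_lo : uniq nodes_lo. Proof. by vm_compute. Qed.

Lemma uniq_hi : uniq nodes_hi. Proof. by vm_compute. Qed.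

Lemma small_lo : small_nodes nodes_lo rs_lo. Proof. by vm_compute. Qed.

Lemma small_hi : small_nodes nodes_hi rs_hi. Proof. by vm_compute. Qed.

(* The ratios 5 and 7 contribute a proportion 1/25 + 1/49 - 2/96, which is
   2327 / (25 * 49 * 48), of progressions of loss [ln (8 / 7)] each. *)
Lemma lo_test :
  (3 * n_unit * (2327 * (3 * precN - log_lo 7) +
     25 * 49 * 48 * (log_hi (1901 * 1000 + 448) - log_lo million))
   <? walk (f_lo nodes_lo) lo_nodes * (25 * 49 * 48))%num.
Proof. by vm_cast_no_check (erefl true). Qed.

(** [walk / (3 * n_unit)] bounds from below the loss per integer, in units of [2 ^ - log_prec] bits;
    the 3 is [6 / 2], from the density of rough numbers. Cleared of denominators, the test says that
    [ln 2] minus this loss is below [ln 1.925556]. *)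
Lemma hi_test :
  (3 * n_unit * (precN + log_hi million) <?
   walk (f_hi nodes_hi) hi_nodes + 3 * n_unit * log_lo (1925 * 1000 + 556))%num.
Proof. by vm_cast_no_check (erefl true). Qed.

(** * Numerical bounds *)

Section Numerics.
Variable R : realType.
Local Notation natN m := ((N.to_nat m)%:R : R).

Lemma count_free_gt0 W rs : uniq W -> (0 < N.to_nat (count_free W rs))%N.
Proof.
move=> uW; rewrite /count_free dp_spec //; last first.
  by apply/negP => /node_edges_inE[t [r []]].
rewrite big_seq1 mul1n cnt_gt0 //.
by apply/negP => /mapP[[|//] /node_edges_inE[t [r []]]].
Qed.

Lemma small_filter (p : pred N) W rs : small_nodes W rs -> small_nodes [seq t <- W | p t] rs.
Proof.
move=> /andP[/allP h hrs]; rewrite /small_nodes hrs andbT.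
by apply/allP => t; rewrite mem_filter => /andP[_ /h].
Qed.

Lemma natN_pow2 k : natN (2 ^ N.of_nat k)%num = 2 ^+ k.
Proof. by rewrite tn_pow Nnat.Nat2N.id natrX. Qed.

Lemma natN_unit : natN n_unit = unit_nat%:R.
Proof. by rewrite /unit_nat -lock. Qed.

Lemma natN_sub_ge m n : natN m - natN n <= natN (m - n)%num.
Proof. by rewrite lerBlDr -natrD ler_nat; lia. Qed.

(** Converts natural logarithms to the scaled binary ones of the computation. *)
Definition scale : R := 2 ^+ log_prec / ln 2.

Lemma ln2_gt0 : 0 < ln 2 :> R.
Proof. by rewrite ln_gt0 // ltr1n. Qed.

Lemma scale_gt0 : 0 < scale.
Proof. by rewrite divr_gt0 ?exprn_gt0 ?ln2_gt0. Qed.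

Definition F_lo (W : seq nat) : R :=
  scale * ln (cnt W (edge_free (gp_on [:: 2; 3; 4; 6; 8; 9]%N W)))%:R.

Definition F_hi (W : seq nat) : R := scale * loss R (gp_on (map nval rs_hi) W).

Lemma rs_loE : map nval rs_lo = [:: 2; 3; 4; 6; 8; 9]%N.
Proof. by []. Qed.

Lemma f_lo_le all t t' : uniq all -> small_nodes all rs_lo ->
  natN (f_lo all t t') <= F_lo (map nval (W_lo all t t')).
Proof.
move=> uall sm; rewrite /F_lo /f_lo; set W := W_lo all t t'.
have uW : uniq W by rewrite filter_uniq.
have e := ln_cnt_count_free R uW (small_filter _ sm); rewrite rs_loE in e.
rewrite {}e /scale mulrAC ler_pdivlMr ?ln2_gt0 //.
exact/log_lo_le/count_free_gt0.
Qed.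

Lemma f_hi_le all t t' : uniq all -> small_nodes all rs_hi ->
  natN (f_hi all t t') <= F_hi (map nval (W_hi all t t')).
Proof.
move=> uall sm; rewrite /F_hi /f_hi; set W := W_hi all t t'.
have uW : uniq W by rewrite filter_uniq.
set a := (N.of_nat _ * _)%num; set b := log_hi _.
(* Subtraction in [N] is truncated; when it yields 0, the nonnegativity of the loss suffices. *)
case: (leqP (N.to_nat a) (N.to_nat b)) => ab.
  rewrite (_ : N.to_nat (a - b) = 0%N); last by lia.
  by rewrite mulr_ge0 ?(ltW scale_gt0) // loss_ge0 // ne_gp_on.
rewrite natN_sub; last by rewrite N_leb_nat ltnW.
rewrite loss_count_free ?small_filter // /scale mulrAC ler_pdivlMr ?ln2_gt0 //.
rewrite /a tnM natrM natN_pow2 Nnat.Nat2N.id mulrBl mulrBr lerB //.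
  by move: (2 ^+ log_prec) => x; rewrite mulrA [x * _]mulrC.
exact/log_hi_ge/count_free_gt0.
Qed.

Lemma D_ge_walk all l d : uniq all -> small_nodes all rs_hi -> chain_ok l ->
  2 * 25 * 49 * d%:R * natN (walk (f_hi all) l) <= scale * D R (n_of d).
Proof.
move=> uall sm hl; pose tab := node_classes (W_hi all) l.
apply: le_trans (_ : scale * (\sum_(m <- iota 1 (n_of d) | pi23^'.-nat m)
    loss R (gp_on (map nval rs_hi) (class_of tab (n_of d %/ m)))) <= _).
  rewrite mulr_sumr; apply: (@walk_le R F_hi (W_hi all) (f_hi all) l d) => //.
    by move=> t t'; apply: f_hi_le.
  by rewrite /F_hi loss_nil mulr0.
rewrite ler_pM2l ?scale_gt0 //; apply: D_ge_classes; first by apply/allP.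
move=> c /node_classesP[t [t' ->]] s /mapP[u + ->].
by rewrite mem_filter /= pi23_nval N_leb_nat => /andP[->].
Qed.

Lemma D_le_walk all l d : uniq all -> small_nodes all rs_lo -> chain_ok l ->
  scale^-1 * (2 * 25 * 49 * d%:R * natN (walk (f_lo all) l)) <=
  (n_of d)%:R * ln 2 - D R (n_of d) +
    (n_of d)%:R * (25^-1 - 96^-1 + (49^-1 - 96^-1)) * ln (8 / 7).
Proof.
move=> uall sm hl; pose tab := node_classes (W_lo all) l.
have walk_bound : 2 * 25 * 49 * d%:R * natN (walk (f_lo all) l) <=
    scale * \sum_(m <- iota 1 (n_of d) | pi23^'.-nat m)
    ln (cnt (class_of tab (n_of d %/ m)) (edge_free (gp_on [:: 2; 3; 4; 6; 8; 9]%N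
        (class_of tab (n_of d %/ m)))))%:R.
  rewrite mulr_sumr; apply: (@walk_le R F_lo (W_lo all) (f_lo all) l d).
  - by move=> t t'; apply: f_lo_le.
  - by rewrite /F_lo ln1 mulr0.
  - exact: hl.
rewrite ler_pdivrMl ?scale_gt0 //; apply: le_trans walk_bound _.
rewrite ler_pM2l ?scale_gt0 //; set S := \sum_(_ <- _ | _) _.
have : D R (n_of d) <= (n_of d)%:R * ln 2 - S +
    ((n_of d %/ 25 - n_of d %/ 96) + (n_of d %/ 49 - n_of d %/ 96))%N%:R * ln (8 / 7).
  apply: D_le_classes => c /node_classesP[t [t' ->]]; split.
    by rewrite (map_inj_uniq nval_inj) filter_uniq.
  move=> s /mapP[u + ->]; rewrite mem_filter => /andP[/andP[h1 h2] _].
  by rewrite N_leb_nat in h1; rewrite N_leb_nat tnM in h2; apply/and3P; rewrite pi23_nval.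
have [k kE] := unit_nat96; have [y yE] : exists y, y = (6 * k * d)%N by eexists.
have [n96 n25 n49] : [/\ n_of d = 25 * 49 * y * 96, n_of d = 96 * 49 * y * 25 &
    n_of d = 96 * 25 * y * 49]%N.
  rewrite /n_of kE yE; move: (96%N) (25%N) (49%N) => u v w.
  by split; rewrite !mulnA; ring.
move: S (D R (n_of d)) (n_of d) n96 n25 n49 => S' D' n n96 n25 n49.
have e96 : (n %/ 96 = 25 * 49 * y)%N by rewrite n96; apply: mulnK.
have e25 : (n %/ 25 = 96 * 49 * y)%N by rewrite n25; apply: mulnK.
have e49 : (n %/ 49 = 96 * 25 * y)%N by rewrite n49; apply: mulnK.
have nR : n%:R = 25 * 49 * 96 * y%:R :> R by rewrite n96 !natrM; ring.
rewrite e96 e25 e49 natrD !natrB ?leq_mul2r ?leq_pmul2l ?leq_pmul2r ?orbT //.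
rewrite nR !natrM; move: (ln 2) (ln (8 / 7)) (y%:R) => u u' z h.
have -> : 25 * 49 * 96 * z * (25^-1 - 96^-1 + (49^-1 - 96^-1)) =
  96 * 49 * z - 25 * 49 * z + (96 * 25 * z - 25 * 49 * z) :> R by field.
by lra.
Qed.

Lemma n_of_real d : (n_of d)%:R = 6 * 25 * 49 * unit_nat%:R * d%:R :> R.
Proof. by rewrite /n_of; move: unit_nat => u; rewrite !natrM. Qed.

Lemma log_lo_real g : (0 <? g)%num -> natN (log_lo g) <= scale * ln (natN g).
Proof.
move=> /N.ltb_lt g0; rewrite /scale mulrAC ler_pdivlMr ?ln2_gt0 //.
by apply: log_lo_le; lia.
Qed.

Lemma log_hi_real g : (0 <? g)%num -> scale * ln (natN g) <= natN (log_hi g).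
Proof.
move=> /N.ltb_lt g0; rewrite /scale mulrAC ler_pdivrMr ?ln2_gt0 //.
by apply: log_hi_ge; lia.
Qed.

Lemma natNM m n : natN (m * n)%num = natN m * natN n.
Proof. by rewrite tnM natrM. Qed.

Lemma natND m n : natN (m + n)%num = natN m + natN n.
Proof. by rewrite tnD natrD. Qed.

Lemma N_ltb_real m n : (m <? n)%num -> natN m < natN n.
Proof. by move=> /N.ltb_lt h; rewrite ltr_nat; lia. Qed.

Lemma natN_lit m (k : nat) : (N.of_nat k =? m)%num -> natN m = k%:R.
Proof. by move=> /N.eqb_eq <-; rewrite Nnat.Nat2N.id. Qed.

Lemma natN3 : natN 3 = 3. Proof. exact: natN_lit. Qed.

Lemma natN_million : natN million = 10 ^+ 6.
Proof. by rewrite /million natNM (@natN_lit 1000%num 1000) //; ring. Qed.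

Lemma natN_theta_lo :
  natN (1901 * 1000 + 448) = 10 ^+ 6 * (1 + 901 / 10 ^+ 3 + 448 / 10 ^+ 6).
Proof.
rewrite natND natNM (@natN_lit 1000%num 1000) // (@natN_lit 1901%num 1901) //.
rewrite (@natN_lit 448%num 448) //.
by field.
Qed.

Lemma natN_theta_hi :
  natN (1925 * 1000 + 556) = 10 ^+ 6 * (1 + 925 / 10 ^+ 3 + 556 / 10 ^+ 6).
Proof.
rewrite natND natNM (@natN_lit 1000%num 1000) // (@natN_lit 1925%num 1925) //.
rewrite (@natN_lit 556%num 556) //.
by field.
Qed.

Lemma lo_test_real (u c x k y w : N) : (3 * u * (c * x + k * y) <? w * k)%num ->
  3 * natN u * (natN c * natN x + natN k * natN y) < natN w * natN k.
Proof. by move=> /N_ltb_real; rewrite !natNM natND !natNM natN3. Qed.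

Lemma hi_test_real (u p x y w : N) : (3 * u * (p + x) <? w + 3 * u * y)%num ->
  3 * natN u * (natN p + natN x) < natN w + 3 * natN u * natN y.
Proof. by move=> /N_ltb_real; rewrite natND !natNM natND natN3. Qed.

Lemma unit_natR_gt0 : 0 < unit_nat%:R :> R.
Proof. by rewrite ltr0n unit_nat_gt0. Qed.

Lemma scale_ln2 : scale * ln 2 = natN precN.
Proof. by rewrite /scale divfK ?gt_eqF ?ln2_gt0 // natN_pow2. Qed.

(** The intermediate constant [C] lets the strict inequality survive the passage to the limit. *)
Lemma H_numeric_lo : exists2 C : R, ln (1 + 901 / 10 ^+ 3 + 448 / 10 ^+ 6) < C &
  forall d, (n_of d)%:R * C <= (n_of d)%:R * ln 2 - D R (n_of d).
Proof.
have theta0 : 0 < 1 + 901 / 10 ^+ 3 + 448 / 10 ^+ 6 :> R by lra.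
have walk_le d := D_le_walk d uniq_lo small_lo chain_lo.
move: (walk _ _) lo_test walk_le => w /lo_test_real test walk_le.
have s0 := scale_gt0; have M0 := unit_natR_gt0.
exists (scale^-1 * natN w / (3 * unit_nat%:R) -
    (25^-1 - 96^-1 + (49^-1 - 96^-1)) * ln (8 / 7)); last first.
  move=> d; rewrite mulrBr lerBlDr [X in _ <= _ + X]mulrA; apply: le_trans _ (walk_le d).
  rewrite n_of_real le_eqVlt; apply/orP; left; apply/eqP.
  move: M0 s0; move: unit_nat%:R scale (natN w) d%:R => M s w' d' M0 s0.
  by field; rewrite !gt_eqF.
have l7 := log_lo_real (g := 7%num) isT.
have lm := log_lo_real (g := million) isT.
have lt := log_hi_real (g := (1901 * 1000 + 448)%num) isT.
have sub1 := natN_sub_ge (3 * precN) (log_lo 7).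
have sub2 := natN_sub_ge (log_hi (1901 * 1000 + 448)) (log_lo million).
have P0 := scale_ln2.
move: test l7 lm lt sub1 sub2 P0; move: (log_lo 7) (log_hi _) (log_lo million) precN.
move=> a7 ah al P test l7 lm lt sub1 sub2 P0.
have e87 : ln (8 / 7) = 3 * ln 2 - ln 7 :> R.
  by rewrite ln_div ?posrE // (_ : 8 = 2 ^+ 3) ?lnXn // -?natrX // mulr_natl.
rewrite natN_theta_lo in lt; rewrite natN_million in lm.
rewrite (@natN_lit 7%num 7) // in l7.
have ten0 : 0 < 10 ^+ 6 :> R by rewrite exprn_gt0.
move: (1 + _ + _) theta0 lt => th th0; rewrite lnM ?posrE // => lt.
rewrite natNM -P0 natN3 in sub1.
have cE : natN 2327 = 2327 by exact: natN_lit.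
have kE : natN (25 * 49 * 48) = 25 * 49 * 48.
  by rewrite !natNM (@natN_lit 25%num 25) // (@natN_lit 49%num 49) // (@natN_lit 48%num 48).
move: test; rewrite cE kE natN_unit e87 {cE kE}.
move: scale unit_nat%:R (natN w) M0 s0 l7 lm lt sub1 sub2 => s M w' M0 s0.
move: (ln 2) (ln 7) (ln th) (ln (10 ^+ 6)) => l2 l7 lth lm.
move: (natN a7) (natN ah) (natN al) (natN (3 * P - a7)) (natN (ah - al)).
move=> r7 rh rl x1 x2 h7 hm ht h1 h2 test.
have [y yE] : exists y, w' = y * (3 * M * s).
  by exists (w' / (3 * M * s)); rewrite divfK // !mulf_neq0 // gt_eqF.
have -> : s^-1 * w' / (3 * M) = y by rewrite yE; field; rewrite !gt_eqF.
have test' : 2327 * x1 + 25 * 49 * 48 * x2 < y * s * (25 * 49 * 48).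
  rewrite -(ltr_pM2l (_ : 0 < 3 * M)) ?mulr_gt0 //; apply: lt_le_trans test _.
  by rewrite yE le_eqVlt; apply/orP; left; apply/eqP; ring.
have : s * (2327 * (3 * l2 - l7) + 25 * 49 * 48 * lth) < s * (y * (25 * 49 * 48)).
  by lra.
rewrite ltr_pM2l //; lra.
Qed.

Lemma H_numeric_hi : exists2 C : R, C < ln (1 + 925 / 10 ^+ 3 + 556 / 10 ^+ 6) &
  forall d, (n_of d)%:R * ln 2 - D R (n_of d) <= (n_of d)%:R * C.
Proof.
have theta0 : 0 < 1 + 925 / 10 ^+ 3 + 556 / 10 ^+ 6 :> R by lra.
have walk_le d := D_ge_walk d uniq_hi small_hi chain_hi.
move: (walk _ _) hi_test walk_le => w /hi_test_real test walk_le.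
have s0 := scale_gt0; have M0 := unit_natR_gt0.
exists (ln 2 - scale^-1 * natN w / (3 * unit_nat%:R)); last first.
  move=> d; rewrite mulrBr lerD2l lerN2; have := walk_le d.
  rewrite -ler_pdivrMl // n_of_real; apply: le_trans.
  rewrite le_eqVlt; apply/orP; left; apply/eqP.
  move: M0 s0; move: unit_nat%:R scale (natN w) d%:R => M s w' d' M0 s0.
  by field; rewrite !gt_eqF.
have lm := log_hi_real (g := million) isT.
have lt := log_lo_real (g := (1925 * 1000 + 556)%num) isT.
have P0 := scale_ln2.
move: test lm lt P0; move: (log_hi _) (log_lo _) precN => ah al P test lm lt P0.
rewrite natN_theta_hi in lt; rewrite natN_million in lm.
have ten0 : 0 < 10 ^+ 6 :> R by rewrite exprn_gt0.
move: (1 + _ + _) theta0 lt => th th0; rewrite lnM ?posrE // => lt.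
move: test; rewrite -P0 natN_unit.
move: scale unit_nat%:R (natN w) M0 s0 lm lt => s M w' M0 s0.
move: (ln 2) (ln th) (ln (10 ^+ 6)) (natN ah) (natN al) => l2 lth lm rh rl hm ht test.
have [y yE] : exists y, w' = y * (3 * M * s).
  by exists (w' / (3 * M * s)); rewrite divfK // !mulf_neq0 // gt_eqF.
have -> : s^-1 * w' / (3 * M) = y by rewrite yE; field; rewrite !gt_eqF.
have test' : s * l2 + rh < y * s + rl.
  rewrite -(ltr_pM2l (_ : 0 < 3 * M)) ?mulr_gt0 //; apply: lt_le_trans test _.
  by rewrite yE le_eqVlt; apply/orP; left; apply/eqP; ring.
have : s * (l2 - y) < s * lth by lra.
by rewrite ltr_pM2l.
Qed.

End Numerics.

(** * Computability *)

(** Arity is the length of the argument list. Closure properties of such functions replace the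
    explicit writing of programs. *)
Definition cf (n : nat) (f : seq nat -> nat) : Prop :=
  exists e, forall s, size s = n -> reval e s (f s).

Lemma eq_cf n f g : (forall s, size s = n -> f s = g s) -> cf n f -> cf n g.
Proof. by move=> fg [e he]; exists e => s sn; rewrite -fg //; apply: he. Qed.

Lemma cf_nth n i : cf n (nth 0%N ^~ i).
Proof. by exists (Proj i) => s _; constructor. Qed.

Lemma cf_subst n m f (gs : seq (seq nat -> nat)) : cf m f -> size gs = m ->
  (forall i, (i < m)%N -> cf n (nth (fun=> 0%N) gs i)) ->
  cf n (fun s => f [seq g s | g <- gs]).
Proof.
move=> [e he] sz hgs.
have [es hes] : exists es, forall s, size s = n -> revals es s [seq g s | g <- gs].
  move: hgs; rewrite -sz; elim: (gs) => [|g l IH] h.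
    by exists [::] => s _; constructor.
  have [es hes] : exists es, forall s, size s = n -> revals es s [seq g s | g <- l].
    by apply: IH => i il; apply: (h i.+1).
  have [e' he'] := h 0%N isT.
  by exists (e' :: es) => s sn; constructor; [apply: he'|apply: hes].
exists (Comp e es) => s sn; apply: reval_Comp (hes _ sn) _.
by apply: he; rewrite size_map.
Qed.

Lemma cf_comp1 n f g : cf 1 f -> cf n g -> cf n (fun s => f [:: g s]).
Proof. by move=> hf hg; apply: (cf_subst (gs := [:: g]) hf) => // -[]. Qed.

(** The [k] leading arguments are loop variables, which a function from outside the loop ignores. *)
Lemma cf_weak k n f : cf n f -> cf (k + n) (fun s => f (drop k s)).
Proof.
move=> hf; pose gs := [seq (fun s : seq nat => nth 0%N s i) | i <- iota k n].
apply: (@eq_cf _ (fun s => f [seq g s | g <- gs])).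
  move=> s sn; congr f; apply: (@eq_from_nth _ 0%N).
    by rewrite !size_map size_iota size_drop sn addKn.
  move=> i; rewrite !size_map size_iota => il.
  rewrite -map_comp (nth_map 0%N) ?size_iota //= nth_iota // nth_drop.
  by [].
apply: cf_subst hf _ _ => [|i il]; first by rewrite size_map size_iota.
by rewrite (nth_map 0%N) ?size_iota //; apply: cf_nth.
Qed.

(** The step of a recursion receives the index, the accumulator and the parameters; a summand or
    factor must not see the accumulator. *)
Lemma cf_skip1 n f : cf n.+1 f -> cf n.+2 (fun s => f (nth 0%N s 0 :: drop 2 s)).
Proof.
move=> hf; pose gs := (fun s : seq nat => nth 0%N s 0) ::
  [seq (fun s : seq nat => nth 0%N s i) | i <- iota 2 n].
apply: (@eq_cf _ (fun s => f [seq g s | g <- gs])).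
  move=> s sn; congr f; rewrite /gs /=; congr cons; apply: (@eq_from_nth _ 0%N).
    by rewrite !size_map size_iota size_drop sn subn2.
  move=> i; rewrite !size_map size_iota => il.
  rewrite -map_comp (nth_map 0%N) ?size_iota //= nth_iota // nth_drop.
  by [].
apply: cf_subst hf _ _ => [|[|i] il]; first by rewrite /= size_map size_iota.
  exact: cf_nth.
by rewrite /= (nth_map 0%N) ?size_iota //; apply: cf_nth.
Qed.

Lemma cf_rec n f g h : cf n f -> cf n.+2 g -> cf n h ->
  cf n (fun s => nat_rect (fun=> nat) (f s) (fun k u => g [:: k, u & s]) (h s)).
Proof.
move=> [e he] [e' he'] hh.
have hr : cf n.+1 (fun s => nat_rect (fun=> nat) (f (behead s))
    (fun k u => g [:: k, u & behead s]) (head 0%N s)).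
  exists (PrimRec e e') => -[|k s] //= [sn]; elim: k => [|k IH] /=.
    by constructor; apply: he.
  by apply: reval_PrimRecS IH _; apply: he'; rewrite /= sn.
pose gs := h :: [seq (fun s : seq nat => nth 0%N s i) | i <- iota 0 n].
have gsE s : size s = n -> [seq g s | g <- gs] = h s :: s.
  move=> sn; rewrite /gs /=; congr cons; apply: (@eq_from_nth _ 0%N).
    by rewrite !size_map size_iota sn.
  move=> i; rewrite !size_map size_iota => il.
  by rewrite -map_comp (nth_map 0%N) ?size_iota //= nth_iota.
apply: eq_cf (cf_subst (gs := gs) hr _ _) => [s sn|//=|[|i] il].
- by rewrite gsE.
- by rewrite /= size_map size_iota.
- exact: hh.
- by rewrite /= (nth_map 0%N) ?size_iota //; apply: cf_nth.
Qed.

Lemma cf_succ n f : cf n f -> cf n (fun s => (f s).+1).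
Proof.
have h1 : cf 1 (fun s => (nth 0%N s 0).+1) by exists Succ => s _; constructor.
exact: cf_comp1 h1.
Qed.

Lemma cf_const n c : cf n (fun=> c).
Proof.
elim: c => [|c IH]; last exact: cf_succ.
by exists Zero => s _; constructor.
Qed.

Lemma cf_add n f g : cf n f -> cf n g -> cf n (fun s => f s + g s)%N.
Proof.
move=> hf hg; apply: eq_cf (cf_rec hf (cf_succ (cf_nth n.+2 1)) hg) => s _ /=.
by elim: (g s) => [|k IH] /=; rewrite ?addn0 // IH addnS.
Qed.

Lemma cf_mul n f g : cf n f -> cf n g -> cf n (fun s => f s * g s)%N.
Proof.
move=> hf hg.
apply: eq_cf (cf_rec (cf_const n 0) (cf_add (cf_nth n.+2 1) (cf_weak 2 hf)) hg) => s _.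
by elim: (g s) => [|k IH] /=; rewrite ?muln0 // IH drop0 mulnS addnC.
Qed.

Lemma cf_exp n f g : cf n f -> cf n g -> cf n (fun s => f s ^ g s)%N.
Proof.
move=> hf hg.
apply: eq_cf (cf_rec (cf_const n 1) (cf_mul (cf_nth n.+2 1) (cf_weak 2 hf)) hg) => s _.
by elim: (g s) => [|k IH] //=; rewrite IH drop0 expnSr.
Qed.

Lemma cf_pred n f : cf n f -> cf n (fun s => (f s).-1).
Proof.
move=> hf; apply: eq_cf (cf_rec (cf_const n 0) (cf_nth n.+2 0) hf) => s _.
by case: (f s).
Qed.

Lemma cf_sub n f g : cf n f -> cf n g -> cf n (fun s => f s - g s)%N.
Proof.
move=> hf hg; apply: eq_cf (cf_rec hf (cf_pred (cf_nth n.+2 1)) hg) => s _.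
by elim: (g s) => [|k IH] /=; rewrite ?subn0 // IH subnS.
Qed.

Lemma cf_odd n f : cf n f -> cf n (fun s => odd (f s) : nat).
Proof.
move=> hf.
apply: eq_cf (cf_rec (cf_const n 0) (cf_sub (cf_const n.+2 1) (cf_nth n.+2 1)) hf) => s _.
by elim: (f s) => [|k IH] //=; rewrite IH; case: (odd k).
Qed.

Lemma cf_sum n F h : cf n.+1 F -> cf n h -> cf n (fun s => \sum_(i < h s) F (val i :: s))%N.
Proof.
move=> hF hh.
apply: eq_cf (cf_rec (cf_const n 0) (cf_add (cf_nth n.+2 1) (cf_skip1 hF)) hh) => s _.
by elim: (h s) => [|k IH] /=; rewrite ?big_ord0 // big_ord_recr IH /= drop0.
Qed.

Lemma cf_prod n F h : cf n.+1 F -> cf n h -> cf n (fun s => \prod_(i < h s) F (val i :: s))%N.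
Proof.
move=> hF hh.
apply: eq_cf (cf_rec (cf_const n 1) (cf_mul (cf_nth n.+2 1) (cf_skip1 hF)) hh) => s _.
by elim: (h s) => [|k IH] /=; rewrite ?big_ord0 // big_ord_recr IH /= drop0.
Qed.

Lemma cf_leq n f g : cf n f -> cf n g -> cf n (fun s => (f s <= g s)%N : nat).
Proof.
move=> hf hg; apply: eq_cf (cf_sub (cf_const n 1) (cf_sub hf hg)) => s _.
by rewrite -subn_eq0; move: (f s - g s)%N => [|k].
Qed.

(* A bounded search: the sum counts the indices below the threshold. *)
Lemma cf_threshold n (P : seq nat -> nat) (h m : seq nat -> nat) :
    cf n.+1 P -> cf n h -> (forall s, m s <= h s)%N ->
    (forall i s, (i < h s)%N -> P (i :: s) = (i < m s)%N) -> cf n m.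
Proof.
move=> hP hh mh PE; apply: eq_cf (cf_sum hP hh) => s _.
rewrite (eq_bigr (fun i : 'I_(h s) => (val i < m s)%N : nat)) => [|i _]; last first.
  exact: (PE i s (ltn_ord i)).
rewrite -(big_mkord xpredT (fun i => (i < m s)%N : nat)) (big_cat_nat (leq0n (m s)) (mh s)) /=.
rewrite (@eq_big_nat _ _ _ 0 (m s) _ (fun=> 1%N)) => [|i /andP[_ im]]; last by rewrite im.
rewrite (@eq_big_nat _ _ _ (m s) (h s) _ (fun=> 0%N)) => [|i /andP[mi _]]; last first.
  by rewrite ltnNge mi.
by rewrite !sum_nat_const_nat subn0 muln1 muln0 addn0.
Qed.

Lemma cf_divn n f g : cf n f -> cf n g -> (forall s, 0 < g s)%N ->
  cf n (fun s => f s %/ g s)%N.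
Proof.
move=> hf hg g0.
apply: (@cf_threshold _ (fun s => ((nth 0%N s 0).+1 * g (drop 1 s) <= f (drop 1 s))%N : nat) f).
- by apply: cf_leq (cf_mul (cf_succ (cf_nth _ 0)) (cf_weak 1 hg)) (cf_weak 1 hf).
- exact: hf.
- by move=> s; apply: leq_div.
- by move=> i s _ /=; rewrite !drop0 -leq_divRL.
Qed.

Definition bit (A i : nat) : bool := odd (A %/ 2 ^ i).

Lemma cf_bit n f g : cf n f -> cf n g -> cf n (fun s => bit (f s) (g s) : nat).
Proof.
move=> hf hg; apply/cf_odd/cf_divn => [//||s]; last by rewrite expn_gt0.
exact: cf_exp (cf_const n 2) hg.
Qed.

Definition bit_set (A : nat) : pred nat := fun x => (0 < x)%N && bit A x.-1.

Lemma bit_small A n i : (A < 2 ^ n)%N -> (n <= i)%N -> bit A i = false.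
Proof.
move=> An ni; rewrite /bit divn_small //; apply: leq_trans An _.
by rewrite leq_exp2l.
Qed.

Lemma bit_add A n i : (A < 2 ^ n)%N -> bit (2 ^ n + A) i = (i == n) || bit A i.
Proof.
move=> An; rewrite /bit; case: (ltngtP i n) => [lt|gt|->] /=.
- rewrite -(subnK (ltnW lt)) expnD divnMDl ?expn_gt0 // oddD oddX.
  by rewrite -subn_gt0 in lt; case: (n - i)%N lt.
- rewrite !divn_small //; first by apply: leq_trans An _; rewrite leq_exp2l // ltnW.
  by apply: leq_trans (_ : 2 ^ n.+1 <= _)%N; rewrite ?leq_exp2l // expnS mul2n -addnn ltn_add2l.
- by rewrite divnDl // divnn expn_gt0 /= divn_small.
Qed.

(** Vertex [x] is the binary digit [x - 1] of [A]. In the reversed list the head is the top digit,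
    so the recursion of [cnt] halves the range of [A]. *)
Lemma cnt_bits n (E : pred (pred nat)) :
  cnt (rev (iota 1 n)) E = (\sum_(A < 2 ^ n) E (bit_set A))%N.
Proof.
elim: n E => [|n IH] E.
  rewrite expn0 big_ord1 /=; congr (E _ : nat); apply: funext => x.
  by rewrite /bit_set /bit div0n andbF.
rewrite -[n.+1]addn1 iotaD rev_cat /= add1n !IH addn1 expnS mul2n -addnn big_split_ord /=.
congr addn; apply: eq_bigr => A _; congr (E _ : nat); apply: funext => x.
by rewrite /bit_set /= bit_add //; case: x.
Qed.

Lemma prod_bool n (P : pred nat) : (\prod_(i < n) P i)%N = all P (iota 0 n) :> nat.
Proof.
elim: n => [|n IH]; first by rewrite big_ord0.
have e : all P (iota 0 n.+1) = all P (iota 0 n) && P n.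
  by rewrite -addn1 iotaD all_cat /= andbT.
by rewrite big_ord_recr IH e /= mulnb.
Qed.

(** A brute-force formula made of bounded sums and products, hence primitive recursive. Digits of
    [A] beyond [n] are 0, which plays the part of the test that the last term is at most [n]. *)
Lemma H_bits n : H n = (\sum_(A < 2 ^ n) \prod_(a < n) \prod_(r < n)
  ~~ [&& bit A a, bit A (a.+1 * r.+2).-1 & bit A (a.+1 * r.+2 ^ 2).-1])%N.
Proof.
rewrite H_cnt -(perm_cnt _ (permEl (perm_rev _))) cnt_bits.
apply: eq_bigr => A _.
pose Q a r := ~~ [&& bit A a, bit A (a.+1 * r.+2).-1 & bit A (a.+1 * r.+2 ^ 2).-1].
rewrite (eq_bigr (fun a : 'I_n => all (Q a) (iota 0 n) : nat)) => [|a _]; last first.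
  by rewrite -prod_bool.
rewrite (prod_bool n (fun a => all (Q a) (iota 0 n))); congr nat_of_bool.
have An := ltn_ord A.
apply/allP/allP => [h a|h e].
  rewrite mem_iota => /andP[_ an]; apply/allP => r _; apply/negP => /and3P[h1 h2 h3].
  have le : (a.+1 * r.+2 ^ 2 <= n)%N.
    rewrite leqNgt; apply/negP => lt; move: h3; rewrite (bit_small An) //.
  have eL : gp_edge (a.+1, r.+2) \in gp predT predT n.
    by apply/gpP; exists a.+1, r.+2.
  move/negP: (h _ eL); by apply; apply/and4P.
move=> /gpP[a0 [r0 [[+ + arn] _ _ ->]]].
case: a0 arn => // a; case: r0 => [|[|r]] // arn _ _.
apply/negP => /= /and4P[h1 h2 h3 _].
have an : (a < n)%N by apply: leq_trans arn; nia.
have rn : (r < n)%N by apply: leq_trans arn; nia.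
have aI : a \in iota 0 n by rewrite mem_iota.
have rI : r \in iota 0 n by rewrite mem_iota.
move: (allP (h a aI) r rI) => /negP; apply.
case/andP: h1 => _ h1; case/andP: h2 => _ h2; case/andP: h3 => _ h3.
by rewrite h1 h2 h3.
Qed.

Lemma cf_H n f : cf n f -> cf n (fun s => H (f s)).
Proof.
move=> hf; have h1 : cf 1 (fun s => H (nth 0%N s 0)); last exact: cf_comp1 h1 hf.
(* The bound variables are [s = [:: r; a; A; n]]. *)
pose v i : seq nat -> nat := nth 0%N ^~ i.
have hv i : cf 4 (v i) by exact: cf_nth.
have hq : cf 4 (fun s => (v 1 s).+1 * (v 0 s).+2)%N.
  by apply: cf_mul; [apply: cf_succ|apply/cf_succ/cf_succ].
have hq2 : cf 4 (fun s => (v 1 s).+1 * (v 0 s).+2 ^ 2)%N.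
  apply: cf_mul; first by apply: cf_succ.
  by apply: cf_exp (cf_const 4 2); apply/cf_succ/cf_succ.
have hbody := cf_sub (cf_const 4 1) (cf_mul (cf_bit (hv 2) (hv 1))
  (cf_mul (cf_bit (hv 2) (cf_pred hq)) (cf_bit (hv 2) (cf_pred hq2)))).
apply: eq_cf (cf_sum (cf_prod (cf_prod hbody (cf_nth 3 2)) (cf_nth 2 1))
  (cf_exp (cf_const 1 2) (cf_nth 1 0))) => s _.
rewrite H_bits; apply: eq_bigr => A _; apply: eq_bigr => a _; apply: eq_bigr => r _.
by rewrite /v /=; case: (bit _ _); case: (bit _ _); case: (bit _ _).
Qed.

(* The integer part of [M * h ^ (1 / n)], for [h <= 2 ^ n]. *)
Definition root_floor (h M n : nat) : nat :=
  (\sum_(j < 2 * M) ((j.+1 ^ n <= h * M ^ n)%N))%N.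

Lemma cf_root_floor n f g h : cf n f -> cf n g -> cf n h ->
  cf n (fun s => root_floor (f s) (g s) (h s)).
Proof.
move=> hf hg hh; rewrite /root_floor.
have body := cf_leq (cf_exp (cf_succ (cf_nth n.+1 0)) (cf_weak 1 hh))
  (cf_mul (cf_weak 1 hf) (cf_exp (cf_weak 1 hg) (cf_weak 1 hh))).
apply: eq_cf (cf_sum body (cf_mul (cf_const n 2) hg)) => s _.
by apply: eq_bigr => j _ /=; rewrite drop0.
Qed.

Lemma root_floorP h M n : (0 < n)%N -> (h <= 2 ^ n)%N -> (0 < M)%N ->
  ((root_floor h M n) ^ n <= h * M ^ n < (root_floor h M n).+1 ^ n)%N.
Proof.
move=> n0 hn M0; pose P p := (p ^ n <= h * M ^ n)%N.
have P0 : exists p, P p by exists 0%N; rewrite /P exp0n.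
have bound p : P p -> (p <= 2 * M)%N.
  by move=> /leq_trans/(_ (leq_mul hn (leqnn _))); rewrite -expnMn leq_exp2r.
case: (ex_maxnP P0 bound) => m Pm max_m.
suff -> : root_floor h M n = m.
  apply/andP; split; first exact: Pm.
  by rewrite ltnNge; apply/negP => /max_m; rewrite ltnn.
rewrite /root_floor (eq_bigr (fun i : 'I_(2 * M) => (val i < m)%N : nat)); last first.
  move=> i _; congr nat_of_bool; apply/idP/idP => [/max_m//|im].
  by apply: leq_trans Pm; rewrite leq_exp2r.
rewrite -(big_mkord xpredT (fun i => (i < m)%N : nat)).
rewrite (big_cat_nat (leq0n m) (bound _ Pm)) /=.
rewrite (@eq_big_nat _ _ _ 0 m _ (fun=> 1%N)) => [|i /andP[_ im]]; last by rewrite im.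
rewrite (@eq_big_nat _ _ _ m (2 * M) _ (fun=> 0%N)) => [|i /andP[mi _]]; last first.
  by rewrite ltnNge mi.
by rewrite !sum_nat_const_nat subn0 muln1 muln0 addn0.
Qed.

Lemma H_le n : (H n <= 2 ^ n)%N.
Proof. by rewrite H_cnt; apply: leq_trans (cnt_le _ _) _; rewrite size_iota. Qed.

Section Computable.
Variable R : realType.

(** Half of the tolerance [2 ^ - k] goes to the distance of the root from [theta], half to rounding
    down to a multiple of [2 ^ - (k + 1)]. *)
Lemma computable_root_limit (theta : R) (N : nat -> nat) :
    cf 1 (fun s => N (nth 0%N s 0)) ->
    (forall k, (0 < N k)%N) ->
    (forall k, `|theta - (H (N k))%:R `^ (N k)%:R^-1| <= 2 ^- k.+1) ->
  computable_real theta.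
Proof.
move=> cN N0 hN.
pose p k := root_floor (H (N k)) (2 ^ k.+1) (N k).
have cvar : cf 1 (nth 0%N ^~ 0%N) := cf_nth 1 0.
have to_comp f : cf 1 (fun s => f (nth 0%N s 0)) -> computable f.
  by move=> [e he]; exists e => n; exact: (he [:: n] erefl).
(* The denominator is [(d k).+1], hence the predecessor. *)
exists p, (fun=> 0%N), (fun k => (2 ^ k.+1).-1); split.
- apply: to_comp.
  exact: (cf_root_floor (cf_H cN) (cf_exp (cf_const 1 2) (cf_succ cvar)) cN).
- by apply: to_comp; exact: cf_const.
- by apply/to_comp/cf_pred; exact: cf_exp (cf_const 1 2) (cf_succ cvar).
move=> k; rewrite prednK ?expn_gt0 // subr0.
set M := (2 ^ k.+1)%N; have M0 : (0 < M)%N by rewrite expn_gt0.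
have MR : 0 < M%:R :> R by rewrite ltr0n.
pose x : R := (H (N k))%:R `^ (N k)%:R^-1.
have xn : x ^+ N k = (H (N k))%:R :> R.
  by rewrite -powR_mulrn ?powR_ge0 // -powRrM mulVf ?powRr1 // pnatr_eq0 -lt0n.
have x0 : 0 <= x by exact: powR_ge0.
have /andP[lo hi] := root_floorP (N0 k) (H_le (N k)) M0.
rewrite -/(p k) in lo hi.
have lo' : (p k)%:R <= x * M%:R.
  rewrite -(@ler_pXn2r _ (N k)) ?nnegrE ?mulr_ge0 // exprMn xn -!natrX -natrM ler_nat.
  exact: lo.
have hi' : x * M%:R < (p k).+1%:R.
  rewrite -(@ltr_pXn2r _ (N k)) ?nnegrE ?mulr_ge0 // exprMn xn -!natrX -natrM ltr_nat.
  exact: hi.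
have dist : `|x - (p k)%:R / M%:R| <= 2 ^- k.+1.
  rewrite (_ : x - _ = (x * M%:R - (p k)%:R) / M%:R); last by field; rewrite gt_eqF.
  rewrite normrM ger0_norm ?subr_ge0 // gtr0_norm ?invr_gt0 //.
  have -> : 2 ^- k.+1 = M%:R^-1 :> R by rewrite /M natrX.
  rewrite ler_pdivrMr // mulVf ?gt_eqF //.
  by rewrite lerBlDr addrC natr1 ltW.
apply: le_trans (ler_distD x _ _) _.
apply: le_trans (lerD (hN k) dist) _.
by rewrite exprS invfM; move: (2 ^- k) => z; lra.
Qed.

End Computable.

(** * The growth rate *)

Section GrowthRate.
Variable R : realType.

(** A crude rate that is easy to invert, from [exp (- x / 2) <= 2 / x] and
    [subexp n >= sqrt (ln n)]. It is all that the limit and the algorithm require. *)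
Lemma subexp_bound (n : nat) : 1 <= ln n%:R :> R -> 1 <= ln (ln n%:R) :> R ->
  10 * ln 2 * expR (- (subexp R n / 2)) <= 20 / Num.sqrt (ln n%:R).
Proof.
move=> L1 LL1; have L0 : 0 < ln n%:R :> R by lra.
set r := Num.sqrt _; have r0 : 0 < r by rewrite sqrtr_gt0.
have rS : r <= subexp R n by apply: ler_wsqrtr; rewrite ler_peMr // ltW.
have e1 : expR (- (subexp R n / 2)) <= 2 / r.
  rewrite expRN; apply: (@le_trans _ _ (1 + subexp R n / 2)^-1).
    by rewrite lef_pV2 ?posrE ?expR_gt0 ?expR_ge1Dx //; lra.
  rewrite -[2 / r]invrK invf_div lef_pV2 ?posrE ?divr_gt0 //; lra.
have l2 := ln2_le1 R; have l0 := ln2_ge_half R.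
have e0 := expR_ge0 (- (subexp R n / 2)).
rewrite (_ : 20 / r = 10 * (2 / r)); last by field; rewrite gt_eqF.
by move: (expR _) (2 / r) e0 e1 => x y x0 xy; nra.
Qed.

Lemma subexp_small (eps : R) : 0 < eps -> exists N : nat, forall n : nat,
  (N <= n)%N -> 1 <= ln n%:R :> R -> 1 <= ln (ln n%:R) :> R ->
  10 * ln 2 * expR (- (subexp R n / 2)) <= eps.
Proof.
move=> e0; pose A : R := expR ((20 / eps) ^+ 2).
exists (Num.truncn A).+1 => n An L1 LL1; apply: le_trans (subexp_bound L1 LL1) _.
have nA : A <= n%:R.
  apply: le_trans (_ : (Num.truncn A).+1%:R <= _); last by rewrite ler_nat.
  exact: ltW (truncnS_gt _).
have LA : (20 / eps) ^+ 2 <= ln n%:R.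
  rewrite -[leLHS]expRK ler_ln ?posrE ?expR_gt0 //.
  exact: lt_le_trans (expR_gt0 _) nA.
have q0 : 0 < 20 / eps by rewrite divr_gt0.
have sq : 20 / eps <= Num.sqrt (ln n%:R).
  by rewrite -[leLHS]ger0_norm ?(ltW q0) // -sqrtr_sqr ler_wsqrtr.
have r0 : 0 < Num.sqrt (ln n%:R) :> R := lt_le_trans q0 sq.
by rewrite ler_pdivrMr // mulrC -ler_pdivrMr.
Qed.

Lemma growth_rate : exists (c : R) (n0 : nat),
  [/\ forall n : nat, (n0 <= n)%N -> [/\ 1 <= ln n%:R :> R, 1 <= ln (ln n%:R) :> R &
        `|ln (H n)%:R / n%:R - c| <= 10 * ln 2 * expR (- (subexp R n / 2))],
      ln (1 + 901 / 10 ^+ 3 + 448 / 10 ^+ 6) < c &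
      c < ln (1 + 925 / 10 ^+ 3 + 556 / 10 ^+ 6)].
Proof.
have [delta [n0 h]] := D_limit R; exists (ln 2 - delta), n0.
have key n : (n0 <= n)%N -> [/\ 1 <= ln n%:R :> R, 1 <= ln (ln n%:R) :> R &
    `|ln (H n)%:R / n%:R - (ln 2 - delta)| <= 10 * ln 2 * expR (- (subexp R n / 2))].
  move=> n0n; have [h1 h2 h3] := h n n0n; split=> //.
  have nR : 0 < n%:R :> R.
    by rewrite ltr0n lt0n; apply/eqP => n0'; move: h1; rewrite n0' ln0 // ler10.
  rewrite (_ : _ - _ = delta - D R n / n%:R) 1?distrC //.
  by rewrite ln_H; field; rewrite gt_eqF.
have n_of_ge d : (d <= n_of d)%N.
  by rewrite /n_of mulnC leq_pmulr // muln_gt0 unit_nat_gt0.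
have approx (eps : R) : 0 < eps -> exists d, [/\ 0 < (n_of d)%:R :> R &
    `|(n_of d)%:R * ln 2 - D R (n_of d) - (n_of d)%:R * (ln 2 - delta)| <=
     (n_of d)%:R * eps].
  move=> e0; have [N hN] := subexp_small e0.
  pose d := (maxn (maxn n0 N) 1)%N; exists d.
  have dn := n_of_ge d.
  have n0d : (n0 <= n_of d)%N.
    by apply: leq_trans dn; rewrite /d !leq_max leqnn.
  have Nd : (N <= n_of d)%N.
    by apply: leq_trans dn; rewrite /d !leq_max leqnn orbT.
  have nR : 0 < (n_of d)%:R :> R.
    by rewrite ltr0n (leq_trans _ dn) // /d leq_max orbT.
  have [h1 h2 h3] := key _ n0d; split=> //.
  rewrite -ln_H; have h4 := le_trans h3 (hN _ Nd h1 h2).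
  rewrite (_ : _ - _ = (n_of d)%:R *
    (ln (H (n_of d))%:R / (n_of d)%:R - (ln 2 - delta))); last by field; rewrite gt_eqF.
  by rewrite normrM gtr0_norm // ler_wpM2l // ltW.
split=> //.
  have [C hC hl] := H_numeric_lo R; apply: lt_le_trans hC _.
  apply/ler_addgt0Pr => eps e0; have [d [nR]] := approx eps e0.
  rewrite ler_norml => /andP[_ up]; have := hl d.
  move: (D _ _) ((n_of d)%:R) (ln 2 - delta) nR up => D' n c nR up lo.
  by rewrite -(ler_pM2l nR); lra.
have [C hC hl] := H_numeric_hi R; apply: le_lt_trans hC.
apply/ler_addgt0Pr => eps e0; have [d [nR]] := approx eps e0.
rewrite ler_norml => /andP[lo _]; have := hl d.
move: (D _ _) ((n_of d)%:R) (ln 2 - delta) nR lo => D' n c nR lo up.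
by rewrite -(ler_pM2l nR); lra.
Qed.

(** Mean value inequality: the derivative of the exponential is at most 2 up to [ln 2]. *)
Lemma expR_dist (x y : R) : x <= ln 2 -> y <= ln 2 ->
  `|expR x - expR y| <= 2 * `|x - y|.
Proof.
wlog xy : x y / x <= y.
  move=> h hx hy; case: (leP x y) => [|/ltW] xy; first exact: h.
  by rewrite distrC [`|x - y|]distrC; apply: h.
move=> hx hy; rewrite distrC [`|x - y|]distrC !ger0_norm ?subr_ge0 ?ler_expR //.
have ey : expR y <= 2 by rewrite -[leRHS](@lnK R) ?posrE // ler_expR.
have := expR_ge1Dx (x - y); rewrite expRD expRN => h.
have y0 := expR_gt0 y.
have : (1 + (x - y)) * expR y <= expR x by rewrite -ler_pdivlMr.
have := expR_ge0 y; nra.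
Qed.

End GrowthRate.

(** * Error term and effective computation of the limit *)

Local Open Scope classical_set_scope.
Local Open Scope ring_scope.

Section Asymptotics.
Variable R : realType.

Lemma H_root (n : nat) :
  (H n)%:R `^ n%:R^-1 = expR (ln (H n)%:R / n%:R) :> R.
Proof. by rewrite /powR pnatr_eq0 gtn_eqF ?H_gt0 // mulrC. Qed.

Lemma ln_H_le (n : nat) : ln (H n)%:R / n%:R <= ln 2 :> R.
Proof.
case: n => [|n]; first by rewrite invr0 mulr0 ln_ge0 // ler1n.
rewrite ler_pdivrMr ?ltr0n // mulr_natr -lnXn // -natrX.
by rewrite ler_ln ?posrE ?ltr0n ?H_gt0 ?expn_gt0 // ler_nat H_le.
Qed.

(** [(1 / 2) ^ 2 = 1 / 4] exceeds [1 / 6 - eps]. When [eps > 1 / 6], the root on the left is that of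
    a negative number, which is 0 by convention. *)
Lemma subexp_half_ge (eps : R) (n : nat) : 0 < eps ->
  1 <= ln n%:R :> R -> 1 <= ln (ln n%:R) :> R ->
  Num.sqrt ((1 / 6 - eps) * ln n%:R * ln (ln n%:R)) <= subexp R n / 2.
Proof.
move=> e0 L1 LL1; rewrite /subexp -mulrA; set P := _ * ln _.
have P0 : 0 <= P by rewrite mulr_ge0 //; lra.
have h2 : 0 <= Num.sqrt P / 2 by rewrite divr_ge0 // sqrtr_ge0.
rewrite -[leRHS]ger0_norm // -sqrtr_sqr ler_wsqrtr // exprMn sqr_sqrtr //.
by rewrite mulrC ler_wpM2l //; lra.
Qed.

Lemma error_term (c : R) (n0 : nat) : 0 < c ->
  (forall n : nat, (n0 <= n)%N -> [/\ 1 <= ln n%:R :> R, 1 <= ln (ln n%:R) :> R &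
     `|ln (H n)%:R / n%:R - c| <= 10 * ln 2 * expR (- (subexp R n / 2))]) ->
  forall eps : R, 0 < eps ->
    exists2 e : nat -> R,
      e =O_\oo (fun n : nat =>
        expR (- Num.sqrt ((1 / 6 - eps) * ln n%:R * ln (ln n%:R)))) &
      \forall n \near \oo, (H n)%:R = expR c `^ (n%:R * (1 + e n)).
Proof.
(* With the relative deviation of [ln (H n) / n] from [c] as [e n], the formula is an identity for
   every [n >= 1]. *)
move=> c0 h eps e0; exists (fun n => ln (H n)%:R / n%:R / c - 1); last first.
  near=> n; have n1 : (0 < n)%N by near: n; exists 1%N.
  rewrite /powR (gt_eqF (expR_gt0 _)) expRK.
  rewrite (_ : _ * c = ln (H n)%:R); last first.
    by field; rewrite gt_eqF // pnatr_eq0 -lt0n n1.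
  by rewrite lnK // posrE ltr0n H_gt0.
apply/eqO_exP; exists (10 * ln 2 / c).
  by rewrite divr_gt0 // mulr_gt0 // ln_gt0 // ltr1n.
near=> n; have n0n : (n0 <= n)%N by near: n; exists n0.
have [L1 LL1 hn] := h _ n0n.
rewrite [X in _ <= _ * X]ger0_norm ?expR_ge0 //.
rewrite (_ : _ - 1 = (ln (H n)%:R / n%:R - c) / c); last first.
  by rewrite mulrBl divff // gt_eqF.
rewrite normrM [X in _ * X]gtr0_norm ?invr_gt0 // [leRHS]mulrAC.
rewrite ler_wpM2r ?invr_ge0 ?(ltW c0) //; apply: le_trans hn _.
rewrite ler_wpM2l ?mulr_ge0 ?ln_ge0 ?ler1n // ler_expR lerN2.
exact: subexp_half_ge.
Unshelve. all: by end_near.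
Qed.

Lemma growth_computable (c : R) (n0 : nat) : c <= ln 2 ->
  (forall n : nat, (n0 <= n)%N -> [/\ 1 <= ln n%:R :> R, 1 <= ln (ln n%:R) :> R &
     `|ln (H n)%:R / n%:R - c| <= 10 * ln 2 * expR (- (subexp R n / 2))]) ->
  computable_real (expR c).
Proof.
(* For this [N] one has [sqrt (ln N) = 2 ^ (k + C) * sqrt (ln 2)]. The summand [n0] passes the
   threshold; the summand 8 gives [r >= 128 * 2 ^ k], where [r >= 80 * 2 ^ k] makes [40 / r] at most
   [2 ^ - (k + 1)]. *)
move=> c2 h; pose C := (n0 + 8)%N; pose N k := (2 ^ 4 ^ (k + C))%N.
apply: (@computable_root_limit R _ N).
- apply: cf_exp; first exact: cf_const.
  apply: cf_exp; first exact: cf_const.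
  by apply: cf_add; [exact: cf_nth | exact: cf_const].
- by move=> k; rewrite expn_gt0.
move=> k; rewrite H_root.
have n0N : (n0 <= N k)%N.
  apply: (@leq_trans (k + C)); first by rewrite /C; lia.
  have h4 : (k + C < 4 ^ (k + C))%N by exact: ltn_expl.
  exact: leq_trans (ltnW h4) (ltnW (ltn_expl _ _)).
have [L1 LL1 hN] := h _ n0N.
apply: le_trans (expR_dist c2 (ln_H_le _)) _; rewrite distrC.
have sb := le_trans hN (subexp_bound L1 LL1).
set r := Num.sqrt _ in sb.
have rge : 2 ^+ (k + C) / 2 <= r.
  rewrite -[leLHS]ger0_norm ?divr_ge0 ?exprn_ge0 // -sqrtr_sqr ler_wsqrtr //.
  rewrite /N natrX lnXn // -[_ *+ (4 ^ _)%N]mulr_natr natrX.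
  rewrite exprMn -exprM mulnC exprM.
  rewrite (_ : 2 ^+ 2 = 4) 1?mulrC ?ler_wpM2r ?exprn_ge0 //; last by ring.
  by have := ln2_ge_half R; lra.
have p0 : 0 < 2 ^+ k :> R by rewrite exprn_gt0.
have p8 : 256 * 2 ^+ k <= 2 ^+ (k + C) :> R.
  rewrite exprD mulrC ler_wpM2l ?(ltW p0) // /C exprD.
  rewrite (_ : 256 = 1 * 2 ^+ 8); last by ring.
  by rewrite ler_wpM2r ?exprn_ge0 // exprn_ege1 // ler1n.
have r0 : 0 < r by lra.
apply: le_trans (_ : 40 / r <= _); first by lra.
rewrite ler_pdivrMr // exprSr mulrC ler_pdivlMr ?mulr_gt0 //.
by move: rge p8; move: (2 ^+ k) (2 ^+ (k + C)) p0 => p q p0 rq qp; lra.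
Qed.

End Asymptotics.

Theorem theorem2p8 (R : realType) :
  exists theta : R,
    [/\ (fun n : nat => (H n)%:R `^ n%:R^-1) @ \oo --> theta,
        forall eps : R, 0 < eps ->
          exists2 e : nat -> R,
            e =O_\oo (fun n : nat =>
              expR (- Num.sqrt ((1 / 6 - eps) * ln n%:R * ln (ln n%:R)))) &
            \forall n \near \oo, (H n)%:R = theta `^ (n%:R * (1 + e n)),
        computable_real theta,
        1 + 901 / 10 ^+ 3 + 448 / 10 ^+ 6 < theta &
        theta < 1 + 925 / 10 ^+ 3 + 556 / 10 ^+ 6].
Proof.
have [c [n0 [h lo hi]]] := growth_rate R.
have c0 : 0 < c by apply: lt_trans lo; rewrite ln_gt0 //; lra.
have c2 : c <= ln 2 by apply: ltW (lt_le_trans hi _); rewrite ler_ln ?posrE; lra.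
exists (expR c); split.
- apply/cvgrPdist_le => eps e0; have [N hN] := subexp_small (divr_gt0 e0 (ltr0n _ 2)).
  near=> n; have n0n : (n0 <= n)%N by near: n; exists n0.
  have [L1 LL1 hn] := h _ n0n.
  have Nn : (N <= n)%N by near: n; exists N.
  rewrite H_root.
  apply: le_trans (expR_dist c2 (ln_H_le _ _)) _; rewrite distrC.
  by have := le_trans hn (hN _ Nn L1 LL1); lra.
- exact: error_term c0 h.
- exact: growth_computable c2 h.
- by rewrite -[ltLHS](@lnK R) ?ltr_expR // posrE; lra.
- by rewrite -[ltRHS](@lnK R) ?ltr_expR // posrE; lra.
Unshelve. all: by end_near.
Qed.
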